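(* Let $V$ be an $\mathbb{F}_2\mathcal{A}_9$-module of dimension $8$ that is an irreducible constituent of the restriction to the alternating group $\mathcal{A}_9$ of the spin module $D^{(5,4)}$ of $\Sigma_9$ over $\mathbb{F}_2$. Then $V$ is of quadratic type, i.e. there is a non-degenerate $\mathcal{A}_9$-invariant quadratic form $Q$ on $V$. Let $\mathcal{A}_8$ be the stabilizer of a point in the natural action of $\mathcal{A}_9$ on $\{1,\dots,9\}$, and let $U$ be an irreducible $\mathbb{F}_2\mathcal{A}_8$-submodule of $V$. Then $U$ is $4$-dimensional and is totally singular with respect to $Q$. Moreover, if $g_1,\dots,g_9$ are a set of left coset representatives for $\mathcal{A}_8$ in $\mathcal{A}_9$, the nine subspaces $g_iU$, $1\leq i\leq 9$, form a complete orthogonal spread in $V$.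
   Context: Quadratic forms. A quadratic form on a vector space $V$ over a finite field $K$ of characteristic 2 is a function $Q:V\to K$ with $Q(\lambda u)=\lambda^2Q(u)$ and $Q(u+v)=Q(u)+Q(v)+f(u,v)$ for all $\lambda\in K$, $u,v\in V$, where $f$ is an alternating bilinear form (the polarization of $Q$). $Q$ is non-degenerate if $f$ is non-degenerate. $Q$ is invariant under a group $G$ acting linearly on $V$ if $Q(gv)=Q(v)$ for all $g\in G$, $v\in V$. A subspace is totally singular if $Q$ vanishes on all its elements. If $|K|=q$, $\dim V=2r$ and $Q$ is non-degenerate of index $r$ (i.e. there is an $r$-dimensional totally singular subspace), a partial orthogonal spread is a set of $r$-dimensional totally singular subspaces that pairwise intersect trivially; it has at most $q^{r-1}+1$ members, and it is called complete if it has exactly $q^{r-1}+1$ members (which is $9$ for $q=2$, $r=4$). Modules for symmetric groups. For a partition $\lambda$ of $n$ with no two equal parts (a 2-regular partition), $D^\lambda$ denotes the corresponding irreducible $\mathbb{F}_2\Sigma_n$-module, in the standard labelling: $D^\lambda=S^\lambda/(S^\lambda\cap (S^\lambda)^\perp)$, where $S^\lambda$ is the Specht module over $\mathbb{F}_2$, a submodule of the permutation module on $\lambda$-tabloids, and $\perp$ is taken with respect to the bilinear form on that permutation module for which the tabloids are orthonormal. The module $D^{(5,4)}$ of $\Sigma_9$ has dimension $16$, and it is known that its restriction to $\mathcal{A}_9$ is the direct sum of two non-isomorphic irreducible $8$-dimensional $\mathbb{F}_2\mathcal{A}_9$-modules. *)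

(* Defs.v *)
From HB Require Import structures.
From mathcomp Require Export all_boot all_order all_fingroup all_algebra.
From mathcomp Require Export all_solvable all_field all_character.

Set Implicit Arguments.
Unset Strict Implicit.
Unset Printing Implicit Defensive.

Import GRing.Theory.
Local Open Scope ring_scope.

(* Modules are right modules: a group element x acts on row
   vectors by u |-> u *m rG x.  This matches left modules for the usual
   composition of permutations, since in MathComp (s * t) x = t (s x); under
   this dictionary left cosets become right cosets H :* g. *)

Section SpechtModules.

Variables (F : fieldType) (n : nat) (la : seq nat).
Implicit Types (s t p g : 'S_n) (T : {set 'S_n}).

(* Meant for sumn la = n.  The k-th cell of the diagram of la, in reading
   order, lies in row reshape_index la k and column reshape_offset la k.
   A permutation s stands for the tableau whose k-th cell has entry s k. *)
Definition tab_row s (x : 'I_n) : nat := reshape_index la (s^-1%g x).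
Definition tab_col s (x : 'I_n) : nat := reshape_offset la (s^-1%g x).

(* The row-equivalence class of a tableau. *)
Definition tabloid s : {set 'S_n} :=
  [set t | [forall x, tab_row t x == tab_row s x]].
Definition tabloids : {set {set 'S_n}} := [set tabloid s | s in [set: 'S_n]].

Definition tabloid_vec T : 'rV[F]_#|tabloids| :=
  \row_j (enum_val j == T)%:R.

Definition tabloid_mx g : 'M[F]_#|tabloids| :=
  \matrix_i tabloid_vec (enum_val i :* g)%g.

Definition col_stab s : {set 'S_n} :=
  [set p : 'S_n | [forall x, tab_col s (p x) == tab_col s x]].

Definition polytabloid s : 'rV[F]_#|tabloids| :=
  \sum_(p in col_stab s) (-1) ^+ odd_perm p *: tabloid_vec (tabloid (s * p)%g).

Definition specht : 'M[F]_#|tabloids| := (\sum_(s : 'S_n) <<polytabloid s>>)%MS.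

(* The orthogonal of specht: the tabloid basis is the standard basis, so the
   form making it orthonormal is (u, v) |-> u *m v^T. *)
Definition specht_perp : 'M[F]_#|tabloids| := kermx specht^T.

Lemma tabloidM s g : (tabloid s :* g)%g = tabloid (s * g)%g.
Proof.
apply/setP=> t; rewrite mem_rcoset !inE.
apply/forallP/forallP=> h x.
  by have := h (g^-1%g x); rewrite /tab_row !invMg !permM invgK permKV.
by have := h (g x); rewrite /tab_row !invMg !permM invgK permK.
Qed.

Lemma tabloids_rcoset T g : T \in tabloids -> (T :* g)%g \in tabloids.
Proof. by case/imsetP=> s _ ->; rewrite tabloidM; apply: imset_f. Qed.

Lemma tabloid_vecM T g :
  T \in tabloids -> tabloid_vec T *m tabloid_mx g = tabloid_vec (T :* g)%g.
Proof.
move=> Tt; apply/rowP=> j; rewrite !mxE.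
rewrite (bigD1 (enum_rank_in Tt T)) //= !mxE enum_rankK_in // eqxx mul1r.
rewrite big1 ?addr0 // => i ne; rewrite !mxE; case: eqP => [e|]; last first.
  by rewrite mul0r.
by case/eqP: ne; apply: enum_val_inj; rewrite enum_rankK_in.
Qed.

Fact tabloid_mx_repr : mx_repr 'Sym_('I_n)%g tabloid_mx.
Proof.
split=> [|x y _ _]; apply/row_matrixP=> i.
  rewrite rowK rcoset1; apply/rowP=> j; rewrite !mxE.
  by rewrite (inj_eq enum_val_inj) eq_sym.
rewrite row_mul !rowK tabloid_vecM ?rcosetM //.
by rewrite tabloids_rcoset // enum_valP.
Qed.
Canonical tabloid_repr := MxRepresentation tabloid_mx_repr.

Lemma polytabloidM s g : polytabloid s *m tabloid_mx g = polytabloid (s * g)%g.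
Proof.
rewrite mulmx_suml [RHS](reindex_inj (conjg_inj g)) /=; apply: eq_big => p.
  rewrite !inE; apply/forallP/forallP=> h x.
    rewrite /tab_col; have := h (g^-1%g x).
    by rewrite /tab_col !invMg conjgE !permM !permK.
  have := h (g x).
  by rewrite /tab_col !invMg conjgE !permM !permK.
move=> _; rewrite -scalemxAl tabloid_vecM ?imset_f // tabloidM odd_permJ.
by rewrite conjgE !mulgA mulgK.
Qed.

Fact specht_module : mxmodule tabloid_repr specht.
Proof.
apply/mxmoduleP=> g _ /=; rewrite /specht sumsmxMr; apply/sumsmx_subP=> s _.
rewrite (eqmxMr _ (genmxE _)) polytabloidM.
by rewrite (sumsmx_sup (s * g)%g) // genmxE.
Qed.

Lemma tr_tabloid_mx g : (tabloid_mx g)^T = tabloid_mx g^-1%g.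
Proof.
apply/matrixP=> i j; rewrite !mxE; congr (_%:R); congr (nat_of_bool _).
by apply/eqP/eqP=> ->; rewrite -rcosetM (mulgV, mulVg) rcoset1.
Qed.

Fact specht_perp_module : mxmodule tabloid_repr specht_perp.
Proof.
apply/mxmoduleP=> g _ /=; apply/sub_kermxP; rewrite -mulmxA.
have /mxmoduleP/(_ g^-1%g (in_setT _))/submxP[C eC] := specht_module.
have -> : tabloid_mx g *m specht^T = specht^T *m C^T.
  by rewrite -trmx_mul -eC /= trmx_mul tr_tabloid_mx invgK.
by rewrite mulmxA mulmx_ker mul0mx.
Qed.

Fact specht_rad_module : mxmodule tabloid_repr (specht :&: specht_perp)%MS.
Proof. by rewrite capmx_module ?specht_module ?specht_perp_module. Qed.

(* section_repr takes the smaller module first: this is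
   specht / (specht :&: specht_perp). *)
Definition specht_quotient_repr :=
  section_repr specht_rad_module specht_module.

End SpechtModules.

Definition irr_constituent (F : fieldType) (gT : finGroupType)
    (G : {group gT}) (m n : nat) (rV : mx_representation F G m)
    (rG : mx_representation F G n) : Prop :=
  exists (Us : seq 'M[F]_n) (compUs : mx_composition_series rG Us),
    (last 0 Us :=: 1%:M)%MS /\
    exists2 i : nat, (i < size Us)%N & mx_rsim rV (series_repr i compUs).

Definition quadratic_form_with (K : fieldType) (V : lmodType K)
    (Q : V -> K) (f : {biscalar V}) : Prop :=
  [/\ forall (a : K) (u : V), Q (a *: u) = a ^+ 2 * Q u,
      forall u : V, f u u = 0
    & forall u v : V, Q (u + v) = Q u + Q v + f u v].

Definition nondegenerate_quadratic_form (K : fieldType) (V : lmodType K)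
    (Q : V -> K) : Prop :=
  exists2 f : {biscalar V}, quadratic_form_with Q f
    & forall u : V, (forall v : V, f u v = 0) -> u = 0.

Definition invariant_form (K : fieldType) (gT : finGroupType)
    (G : {group gT}) (n : nat) (rV : mx_representation K G n)
    (Q : 'rV[K]_n -> K) : Prop :=
  forall (g : gT) (v : 'rV[K]_n), g \in G -> Q (v *m rV g) = Q v.

Definition quadratic_type (K : fieldType) (gT : finGroupType)
    (G : {group gT}) (n : nat) (rV : mx_representation K G n) : Prop :=
  exists2 Q : 'rV[K]_n -> K,
    nondegenerate_quadratic_form Q & invariant_form rV Q.

Definition totally_singular (K : fieldType) (n m : nat)
    (Q : 'rV[K]_n -> K) (W : 'M[K]_(m, n)) : Prop :=
  forall v : 'rV[K]_n, (v <= W)%MS -> Q v = 0.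

(* A set of subspaces is a set of canonical generating matrices <<W>>, so that
   distinct members are distinct subspaces. *)
Definition partial_orthogonal_spread (K : finFieldType) (r n : nat)
    (Q : 'rV[K]_n -> K) (S : {set 'M[K]_n}) : Prop :=
  [/\ n = (2 * r)%N,
      nondegenerate_quadratic_form Q,
      exists2 W : 'M[K]_n, \rank W = r & totally_singular Q W,
      forall W : 'M[K]_n, W \in S ->
        [/\ <<W>>%MS = W, \rank W = r & totally_singular Q W]
    & forall W W' : 'M[K]_n, W \in S -> W' \in S -> W != W' ->
        (W :&: W' = 0)%MS].

Definition complete_orthogonal_spread (K : finFieldType) (r n : nat)
    (Q : 'rV[K]_n -> K) (S : {set 'M[K]_n}) : Prop :=
  partial_orthogonal_spread r Q S /\ #|S| = (#|K| ^ r.-1 + 1)%N.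

Definition coset_representatives (gT : finGroupType) (H G : {set gT})
    (I : Type) (g : I -> gT) : Prop :=
  (forall i, g i \in G) /\
  (forall x, x \in G -> exists! i, x \in (H :* g i)%g).

(* Main.v *)
From HB Require Import structures.
From Stdlib Require Import BinNat.
Require Import Defs.
From mathcomp Require Import zify.

(* An extended Hamming code H on eight of the nine points defines a functional
   on the permutation module of 4-subsets, T |-> [T \in H].  On the Specht
   module S these functionals span an 8-dimensional space for each of the two
   A_9-classes of such codes, with linear relations that hold up to functions of
   degree at most 3 in the membership bits of T, and those vanish on S.  Their
   common kernel on S is its radical, so that D^(5,4) is the sum of two explicit
   half-spin modules, and V is one of them.
   In Hamming coordinates \sum_(i < 4) x_i x_(7 - i) is an invariant quadratic
   form.  A 2-subgroup of A_8 fixes a single nonzero vector of V; hence every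
   nonzero A_8-submodule contains that vector and its A_8-orbit, which together
   with 0 is a subspace of dimension 4.  An invariant form is constant on this
   orbit, and then zero because its polarization is additive.  Since A_9 is
   2-transitive on points, two members of the spread meet trivially as soon as
   one given pair does. *)

Set Implicit Arguments.
Unset Strict Implicit.
Unset Printing Implicit Defensive.

(** * The two half-spin modules in coordinates *)

(* An element of 'F_2^8 is coded by an integer below 2^8, the i-th bit being
   the i-th coordinate, and a matrix by the list of the codes of its rows. *)
Fixpoint mulN (rows : seq N) (a : N) : N :=
  if rows is r :: rows' then
    N.lxor (if N.odd a then r else 0%num) (mulN rows' (N.div2 a))
  else 0%num.

(* The transposition (0 x) exchanges the two half-spin modules: [rows01 x] and
   [rows10 x] are its matrices from the first to the second and back. *)
Definition rows01 (x : nat) : seq N :=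
  match x with
  | 1 => [:: 1; 2; 4; 8; 16; 32; 64; 128]%num
  | 2 => [:: 3; 1; 10; 15; 32; 48; 240; 80]%num
  | 3 => [:: 2; 3; 12; 4; 48; 16; 128; 192]%num
  | 4 => [:: 13; 4; 6; 7; 144; 208; 112; 16]%num
  | 5 => [:: 12; 7; 14; 3; 176; 192; 48; 208]%num
  | 6 => [:: 14; 6; 2; 11; 128; 224; 176; 144]%num
  | 7 => [:: 15; 5; 8; 12; 162; 243; 204; 68]%num
  | 8 => [:: 63; 21; 136; 204; 160; 240; 192; 64]%num
  | _ => [::]
  end.

Definition rows10 (x : nat) : seq N :=
  match x with
  | 1 => [:: 1; 2; 4; 8; 16; 32; 64; 128]%num
  | 2 => [:: 2; 3; 14; 7; 48; 16; 176; 208]%num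
  | 3 => [:: 3; 1; 8; 12; 32; 48; 192; 64]%num
  | 4 => [:: 12; 6; 2; 15; 128; 240; 48; 144]%num
  | 5 => [:: 13; 5; 10; 11; 160; 224; 112; 80]%num
  | 6 => [:: 15; 4; 6; 3; 144; 192; 240; 16]%num
  | 7 => [:: 14; 7; 12; 4; 178; 211; 140; 196]%num
  | 8 => [:: 62; 23; 140; 196; 176; 208; 128; 192]%num
  | _ => [::]
  end.

Definition half_rows (k : bool) : nat -> seq N := if k then rows10 else rows01.

(** [k] names the half containing [a], [false] for the first and [true] for the second; every letter
    leads to the other half. *)
Fixpoint walk (k : bool) (w : seq nat) (a : N) : N :=
  if w is x :: w' then walk (~~ k) w' (mulN (half_rows k x) a) else a.

Definition codes : seq N := [seq N.of_nat i | i <- iota 0 256].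
(** The span of the first four coordinate vectors, which turns out to be the smallest nonzero
    A_8-submodule of either half. *)
Definition low_codes : seq N := [seq N.of_nat i | i <- iota 0 16].

Lemma mulN0 (rows : seq N) : mulN rows 0 = 0%num.
Proof. by elim: rows => //= r rows ->. Qed.

(** Words for the even permutations of {0, .., n - 1}: [n = 8] gives the stabilizer A_8 of the point
    8, and [n = 9] gives A_9. *)
Definition even_word (n : nat) (w : seq nat) : bool :=
  all (fun x => 0 < x < n) w && ~~ odd (size w).

(** Submodules as predicates: products of two transpositions (0 x) with 0 < x < n generate the
    alternating group on {0, .., n - 1}, and 0 arises as a sum a + a. *)
Definition walk_closed (n : nat) (k : bool) (P : N -> Prop) : Prop :=
  (forall a b, P a -> P b -> P (N.lxor a b)) /\
  (forall x y a, 0 < x < n -> 0 < y < n -> P a -> P (walk k [:: x; y] a)).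

Lemma walk_closedW (m n : nat) (k : bool) (P : N -> Prop) :
  m <= n -> walk_closed n k P -> walk_closed m k P.
Proof.
move=> le_mn [Padd Pwalk]; split=> // x y a /andP[x0 xm] /andP[y0 ym].
by apply: Pwalk; rewrite ?x0 ?y0 /= ?(leq_trans xm) ?(leq_trans ym).
Qed.

Lemma walk_closed_word (n : nat) (k : bool) (P : N -> Prop) (w : seq nat) (a : N) :
  walk_closed n k P -> even_word n w -> P a -> P (walk k w a).
Proof.
move=> [_ Pwalk]; have [m] := ubnP (size w); elim: m w k a Pwalk => // m IH.
rewrite /even_word => -[|x [|y w]] k a Pwalk; rewrite /= ?andbF //= => ltwm.
case/andP=> /and3P[xn yn wn]; rewrite negbK => ev Pa; rewrite negbK.
apply: IH => //; first exact: ltnW.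
  by rewrite /even_word wn.
by have /= := Pwalk x y a xn yn Pa; rewrite ?negbK.
Qed.

(** In characteristic 2 this applies w - 1, which stays inside any submodule and kills exactly the
    fixed vectors of [w]. *)
Definition move (k : bool) (w : seq nat) (a : N) : N := N.lxor a (walk k w a).
Definition moves (k : bool) (ws : seq (seq nat)) (a : N) : N :=
  foldl (fun b w => move k w b) a ws.

Lemma walk_closed_moves (n : nat) (k : bool) (P : N -> Prop)
    (ws : seq (seq nat)) (a : N) :
  walk_closed n k P -> all (even_word n) ws -> P a -> P (moves k ws a).
Proof.
move=> cP; elim: ws a => //= w ws IH a /andP[ew ews] Pa; apply: IH => //.
by apply: cP.1 => //; apply: walk_closed_word cP ew Pa.
Qed.

(* Even involutions generating a 2-subgroup of the stabilizer of 8 that fixes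
   only one nonzero vector, with code 1, in the half [k]. *)
Definition reducers (k : bool) : seq (seq nat) :=
  [:: [:: 1; 2; 3; 2];
      if k then [:: 1; 4; 1; 5; 2; 6; 2; 3; 7; 3]
      else [:: 4; 1; 5; 1; 2; 6; 2; 3; 7; 3]].

Definition reducing (k : bool) (a : N) : seq (seq nat) :=
  [seq w <- reducers k | move k w a != 0%num].

(* Replacing a by a + a w, for w in [reducers k], as long as this is not 0 ends at
   the common fixed vector of the reducers. *)
Fixpoint reduction (k : bool) (fuel : nat) (a : N) : seq (seq nat) :=
  if fuel is fuel'.+1 then
    if reducing k a is w :: _ then w :: reduction k fuel' (move k w a) else [::]
  else [::].

Lemma reduction_even (k : bool) (fuel : nat) (a : N) :
  all (even_word 8) (reduction k fuel a).
Proof.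
elim: fuel a => //= fuel IH a; case eq_ws: (reducing k a) => [//|w ws] /=.
rewrite IH andbT; have : w \in reducing k a by rewrite eq_ws mem_head.
by rewrite mem_filter => /andP[_]; apply: (allP _ w); case: (k).
Qed.

Lemma mem_halves (k : bool) : k \in [:: false; true].
Proof. by case: k. Qed.

(** Four rounds suffice for each of the 255 nonzero vectors of either half. *)
Lemma reduction_check :
  all (fun k => all (fun a => (a == 0%num) ||
                              (moves k (reduction k 4 a) a == 1%num)) codes)
      [:: false; true].
Proof. by vm_compute. Qed.

Lemma moves_reduction (k : bool) (a : N) :
  a \in codes -> a != 0%num -> moves k (reduction k 4 a) a = 1%num.
Proof.
move=> ca a0; have /allP/(_ k (mem_halves k))/allP/(_ a ca) := reduction_check.
by rewrite (negPf a0) => /eqP.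
Qed.

(** Each step of the reduction adds to a vector its image under an element of A_8, so the whole
    reduction stays in the submodule. *)
Lemma walk_closed_one (k : bool) (P : N -> Prop) (a : N) :
  walk_closed 8 k P -> a \in codes -> a != 0%num -> P a -> P 1%num.
Proof.
move=> cP ca a0 Pa; rewrite -(moves_reduction k ca a0).
by apply: walk_closed_moves cP _ Pa; apply: reduction_even.
Qed.

(** Words of two letters already carry the vector 1 to all 15 nonzero vectors of the low
    subspace. *)
Lemma low_orbit_check :
  all (fun k => all (fun v => (v == 0%num) ||
     (v \in [seq walk k [:: x; y] 1%num | x <- iota 1 7, y <- iota 1 7])) low_codes)
   [:: false; true].
Proof. by vm_compute. Qed.

Lemma low_orbit (k : bool) (v : N) :
  v \in low_codes -> v != 0%num ->
  exists x y, [/\ 0 < x < 8, 0 < y < 8 & v = walk k [:: x; y] 1%num].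
Proof.
move=> cv v0; have /allP/(_ k (mem_halves k))/allP/(_ v cv) := low_orbit_check.
rewrite (negPf v0) => /allpairsP[[x y] [xi yi ->]].
by rewrite !mem_iota in xi yi; exists x, y; split.
Qed.

Lemma walk_closed_low (k : bool) (P : N -> Prop) (v : N) :
  walk_closed 8 k P -> P 1%num -> v \in low_codes -> P v.
Proof.
move=> cP P1 cv; have [->|v0] := eqVneq v 0%num.
  (* Closure under addition yields 0 as 1 + 1. *)
  by have := cP.1 _ _ P1 P1.
by have [x [y [xn yn ->]]] := low_orbit k cv v0; apply: cP.2.
Qed.

Lemma full_check :
  all (fun k => all (fun a => has (fun u => has (fun v =>
    a == N.lxor u (walk k [:: 8; 7] v)) low_codes) low_codes) codes)
   [:: false; true].
Proof. by vm_compute. Qed.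

(** Each half is the sum of the low subspace and its image under (0 8)(0 7). Together with
    [walk_closed_one] this makes the half irreducible under A_9. *)
Lemma walk_closed_full (k : bool) (P : N -> Prop) (a : N) :
  walk_closed 9 k P -> P 1%num -> a \in codes -> P a.
Proof.
move=> cP P1 ca; have /allP/(_ k (mem_halves k))/allP/(_ a ca) := full_check.
case/hasP=> u cu /hasP[v cv /eqP->].
have low := walk_closed_low (walk_closedW (leqnSn 8) cP) P1.
by apply: cP.1; [apply: low | apply: cP.2 => //; apply: low].
Qed.

Lemma low_stable_check :
  all (fun k => all (fun v => all (fun x => all (fun y =>
    walk k [:: x; y] v \in low_codes) (iota 1 7)) (iota 1 7)) low_codes)
  [:: false; true].
Proof. by vm_compute. Qed.

Lemma low_stable (k : bool) (x y : nat) (v : N) :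
  0 < x < 8 -> 0 < y < 8 -> v \in low_codes -> walk k [:: x; y] v \in low_codes.
Proof.
move=> xn yn cv; have /allP/(_ k (mem_halves k))/allP/(_ v cv) := low_stable_check.
by move=> /allP/(_ x)/[!mem_iota]/(_ xn)/allP/(_ y)/[!mem_iota]/(_ yn).
Qed.

(** The one pair of subspaces whose intersection is computed; the other pairs of the spread are
    moved to this one. *)
Lemma low_disjoint_check :
  all (fun k => all (fun v => (walk k [:: 8; 7] v \in low_codes) ==> (v == 0%num))
    low_codes) [:: false; true].
Proof. by vm_compute. Qed.

Lemma low_disjoint (k : bool) (v : N) :
  v \in low_codes -> walk k [:: 8; 7] v \in low_codes -> v = 0%num.
Proof.
move=> cv; have /allP/(_ k (mem_halves k))/allP/(_ v cv) := low_disjoint_check.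
by move=> /implyP H dv; apply/eqP/H.
Qed.

(* Even words that fix the vector 1 of the first half, while their only common
   fixed vector in the second half is 0. *)
Definition separators : seq (seq nat) :=
  [:: [:: 2; 4; 2; 6]; [:: 3; 4; 3; 7]] ++ reducers false.

Lemma separators_check :
  all (fun w => even_word 9 w && (move false w 1 == 0%num)) separators &&
  all (fun b => (b == 0%num) || has (fun w => move true w b != 0%num) separators)
    codes.
Proof. by vm_compute. Qed.

Lemma low_codesS : {subset low_codes <= codes}.
Proof. by apply/allP; vm_compute. Qed.

(** * Submodules of the sum of the two halves *)

Definition xor2 (u v : N * N) : N * N := (N.lxor u.1 v.1, N.lxor u.2 v.2).

Definition swap2 (x : nat) (v : N * N) : N * N :=
  (mulN (rows10 x) v.2, mulN (rows01 x) v.1).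

Definition in_half (k : bool) (a : N) : N * N :=
  if k then (0%num, a) else (a, 0%num).

Definition swap2_closed (P : N * N -> Prop) : Prop :=
  (forall u v, P u -> P v -> P (xor2 u v)) /\
  (forall x y u, 0 < x < 9 -> 0 < y < 9 -> P u -> P (swap2 y (swap2 x u))).

Lemma swap2_closed_half (P : N * N -> Prop) (k : bool) :
  swap2_closed P -> walk_closed 9 k (fun a => P (in_half k a)).
Proof.
move=> [Padd Pswap]; split=> [a b Pa Pb|x y a xn yn Pa].
  by have := Padd _ _ Pa Pb; case: k {Pa Pb}.
have := Pswap x y _ xn yn Pa.
by case: k {Pa}; rewrite /swap2 /= !mulN0.
Qed.

Lemma swap2_closed_word (P : N * N -> Prop) (w : seq nat) (a b : N) :
  swap2_closed P -> even_word 9 w -> P (a, b) ->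
  P (walk false w a, walk true w b).
Proof.
move=> [_ Pswap]; have [m] := ubnP (size w); elim: m w a b => // m IH.
rewrite /even_word => -[|x [|y w]] a b; rewrite /= ?andbF //= => ltwm.
case/andP=> /and3P[xn yn wn]; rewrite negbK => ev Pab.
apply: IH => //; first exact: ltnW.
  by rewrite /even_word wn.
exact: Pswap x y _ xn yn Pab.
Qed.

Lemma swap2_closed_moves (P : N * N -> Prop) (ws : seq (seq nat)) (a b : N) :
  swap2_closed P -> all (even_word 9) ws -> P (a, b) ->
  P (moves false ws a, moves true ws b).
Proof.
move=> cP; elim: ws a b => //= w ws IH a b /andP[ew ews] Pab; apply: IH => //.
exact: (cP.1 _ _ Pab (swap2_closed_word cP ew Pab)).
Qed.

(** Shifts commute with [N.lxor], so this description makes the closure of [codes] under addition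
    immediate. *)
Lemma mem_codes (a : N) : (a \in codes) = (N.shiftr a 8 == 0%num).
Proof.
apply/idP/eqP=> [|a8].
  suff /allP H : all (fun b => N.shiftr b 8 == 0%num) codes by move/H/eqP.
  by vm_compute.
have lta : (a < 256)%num.
  by move: a8; rewrite N.shiftr_div_pow2 N.div_small_iff.
apply/mapP; exists (N.to_nat a); last by rewrite Nnat.N2Nat.id.
by rewrite mem_iota add0n; apply/ltP; lia.
Qed.

Lemma lxor_codes (a b : N) :
  a \in codes -> b \in codes -> N.lxor a b \in codes.
Proof. by rewrite !mem_codes N.shiftr_lxor => /eqP-> /eqP->. Qed.

Lemma codes0 : 0%num \in codes.
Proof. by rewrite mem_codes. Qed.

Lemma mulN_codes (rows : seq N) (a : N) :
  all (mem codes) rows -> mulN rows a \in codes.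
Proof.
elim: rows a => [|r rows IH] a /=; first by rewrite codes0.
move=> /andP[cr /IH crows]; apply: lxor_codes => //.
by case: N.odd => //; apply: codes0.
Qed.

Lemma half_rows_codes (k : bool) (x : nat) : all (mem codes) (half_rows k x).
Proof. by case: k; do 9?[case: x => [|x] //]; vm_compute. Qed.

Lemma size_half_rows (k : bool) (x : nat) : size (half_rows k x) <= 8.
Proof. by case: k; do 9?[case: x => [|x] //]. Qed.

Lemma walk_codes (k : bool) (w : seq nat) (a : N) :
  a \in codes -> walk k w a \in codes.
Proof.
elim: w k a => //= x w IH k a ca; apply: IH.
by apply: mulN_codes; apply: half_rows_codes.
Qed.

Lemma moves_codes (k : bool) (ws : seq (seq nat)) (a : N) :
  a \in codes -> moves k ws a \in codes.
Proof.
elim: ws a => //= w ws IH a ca; apply: IH.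
by apply: lxor_codes => //; apply: walk_codes.
Qed.

Lemma reduction_even9 (k : bool) (a : N) :
  all (even_word 9) (reduction k 4 a).
Proof.
apply: sub_all (reduction_even k 4 a) => w /andP[wn ev].
rewrite /even_word ev andbT; apply: sub_all wn => x /andP[-> /=].
exact: ltnW.
Qed.

(** If the first component is nonzero, reduce it to the fixed vector 1. Either the second component
    has then become 0, or some separator fixes 1 and moves the second component, and the difference
    is a nonzero vector of the second half. The separators thus witness that the halves are not
    isomorphic. *)
Lemma swap2_closed_in_half (P : N * N -> Prop) (a b : N) :
    swap2_closed P -> a \in codes -> b \in codes ->
    P (a, b) -> (a, b) <> (0, 0)%num ->
  exists k, forall c, c \in codes -> P (in_half k c).
Proof.
move=> cP ca cb Pab ab0.
(* By irreducibility one nonzero vector of a half yields the whole half. *)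
have full k : (exists2 c, c \in codes & c != 0%num /\ P (in_half k c)) ->
    forall c, c \in codes -> P (in_half k c).
  case=> c cc [c0 Pc] d cd; have cPk := swap2_closed_half k cP.
  apply: (walk_closed_full cPk) => //.
  exact: (walk_closed_one (walk_closedW (leqnSn 8) cPk) cc c0 Pc).
have [a0|a0] := eqVneq a 0%num.
  have b0 : b != 0%num by apply/eqP=> b0; apply: ab0; rewrite a0 b0.
  by exists true; apply: full; exists b => //; split=> //; rewrite /in_half -a0.
have := swap2_closed_moves cP (reduction_even9 false a) Pab.
rewrite moves_reduction //; set b' := moves _ _ b => Pb'.
have cb' : b' \in codes by apply: moves_codes.
have [b0|b0] := eqVneq b' 0%num.
  by rewrite b0 in Pb'; exists false; apply: full; exists 1%num.
have /andP[/allP fix1 /allP/(_ b' cb')] := separators_check.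
rewrite (negPf b0) => /hasP[w sw mw]; have /andP[ew /eqP w1] := fix1 w sw.
exists true; apply: full; exists (move true w b').
  by apply: lxor_codes => //; apply: walk_codes.
split=> //; suff -> : in_half true (move true w b') =
    xor2 (1%num, b') (walk false w 1%num, walk true w b').
  exact: cP.1 Pb' (swap2_closed_word cP ew Pb').
by rewrite /in_half /xor2 -[N.lxor 1 _]/(move false w 1) w1.
Qed.

(** If the smaller submodule contains one half, it meets the other half trivially and the larger one
    contains that other half. If it contains neither, it is zero by [swap2_closed_in_half], and any
    half inside the larger one will do. *)
Lemma half_between (PX PY : pred (N * N)) (a b : N) :
    swap2_closed PX -> swap2_closed PY -> subpred PY PX ->
    PY (0, 0)%num ->
    a \in codes -> b \in codes -> PX (a, b) -> ~~ PY (a, b) ->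
  exists k, (forall c, c \in codes -> PX (in_half k c)) /\
            (forall c, c \in codes -> PY (in_half k c) -> c = 0%num).
Proof.
move=> cX cY sYX zY ca cb Xab nYab.
have full k c : c \in codes -> c != 0%num -> PY (in_half k c) ->
    forall d, d \in codes -> PY (in_half k d).
  move=> cc c0 Yc d cd; have cYk := swap2_closed_half k cY.
  apply: (walk_closed_full cYk) => //.
  exact: (walk_closed_one (walk_closedW (leqnSn 8) cYk) cc c0 Yc).
have xor_ab : (a, b) = xor2 (a, 0%num) (0%num, b) by rewrite /xor2 /= N.lxor_0_r.
(* When [PY] contains the first half, the second component of the given pair lies in [PX] but not in
   [PY]. *)
have [Y0|nY0] := boolP (PY (in_half false 1)).
  have Ya : PY (a, 0%num) := full false 1%num isT isT Y0 a ca.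
  have nYb : ~~ PY (0%num, b).
    by apply: contra nYab => Yb; rewrite xor_ab; apply: cY.1.
  have Xb : PX (0%num, b).
    have := cX.1 _ _ Xab (sYX _ Ya).
    by rewrite /xor2 /= N.lxor_nilpotent N.lxor_0_r.
  have b0 : b != 0%num.
    apply: contra nYb => /eqP->.
    by have := cY.1 _ _ Ya Ya; rewrite /xor2 /= N.lxor_nilpotent.
  exists true; split=> [c cc|c cc Yc].
    have cXk := swap2_closed_half true cX.
    apply: (walk_closed_full cXk) => //.
    exact: (walk_closed_one (walk_closedW (leqnSn 8) cXk) cb b0 Xb).
  apply/eqP; apply: contraT => c0.
  by case/negP: nYb; apply: full true c cc c0 Yc b cb.
have [Y1|nY1] := boolP (PY (in_half true 1)).
  have Yb : PY (0%num, b) := full true 1%num isT isT Y1 b cb.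
  have nYa : ~~ PY (a, 0%num).
    by apply: contra nYab => Ya; rewrite xor_ab; apply: cY.1.
  have Xa : PX (a, 0%num).
    have := cX.1 _ _ Xab (sYX _ Yb).
    by rewrite /xor2 /= N.lxor_nilpotent N.lxor_0_r.
  have a0 : a != 0%num.
    apply: contra nYa => /eqP->.
    by have := cY.1 _ _ Yb Yb; rewrite /xor2 /= N.lxor_nilpotent.
  exists false; split=> [c cc|c cc Yc].
    have cXk := swap2_closed_half false cX.
    apply: (walk_closed_full cXk) => //.
    exact: (walk_closed_one (walk_closedW (leqnSn 8) cXk) ca a0 Xa).
  apply/eqP; apply: contraT => c0.
  by case/negP: nYa; apply: full false c cc c0 Yc a ca.
(* Here [PY] contains neither half, hence it is zero. *)
have Y00 u v : u \in codes -> v \in codes -> PY (u, v) -> (u, v) = (0, 0)%num.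
  move=> cu cv Yuv; apply/eqP; apply: contraT => /eqP uv0.
  have [k Yk] := swap2_closed_in_half cY cu cv Yuv uv0.
  by have := Yk 1%num isT; case: k {Yk}; rewrite ?(negPf nY0) ?(negPf nY1).
have PY0 c k : c \in codes -> PY (in_half k c) -> c = 0%num.
  move=> cc; case: k => Yc; first by case: (Y00 _ _ codes0 cc Yc).
  by case: (Y00 _ _ cc codes0 Yc).
have ab0 : (a, b) <> (0, 0)%num.
  by move=> ab0; rewrite ab0 zY in nYab.
have [k Xk] := swap2_closed_in_half cX ca cb Xab ab0.
by exists k; split=> // c cc; apply: PY0.
Qed.

(** * Words in the transpositions (0 x) *)

Definition star (x : nat) : 'S_9 := tperm ord0 (inord x).
Definition star_perm (w : seq nat) : 'S_9 := (\prod_(x <- w) star x)%g.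

Lemma star_perm_cons (x : nat) (w : seq nat) :
  star_perm (x :: w) = (star x * star_perm w)%g.
Proof. exact: big_cons. Qed.

Lemma star_perm_cat (w1 w2 : seq nat) :
  star_perm (w1 ++ w2) = (star_perm w1 * star_perm w2)%g.
Proof. exact: big_cat. Qed.

Lemma odd_star (x : nat) : 0 < x < 9 -> odd_perm (star x).
Proof.
case/andP=> x0 x9; rewrite /star odd_tperm; apply: contraTneq x0 => /(congr1 val).
by rewrite /= inordK // => <-.
Qed.

Lemma odd_star_perm (w : seq nat) :
  all (fun x => 0 < x < 9) w -> odd_perm (star_perm w) = odd (size w).
Proof.
elim: w => [|x w IH] /=; first by rewrite /star_perm big_nil odd_perm1.
by case/andP=> xn wn; rewrite star_perm_cons odd_permM odd_star // IH.
Qed.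

(** Induction on n: composing [s] with the transposition of n - 1 and its image gives a permutation
    that fixes n - 1 as well. *)
Lemma star_perm_gen (n : nat) (s : 'S_9) :
    n <= 9 -> (forall i : 'I_9, n <= i -> s i = i) ->
  exists2 w, all (fun x => 0 < x < n) w & s = star_perm w.
Proof.
elim: n s => [|n IH] s n9 fixs.
  exists [::] => //; rewrite /star_perm big_nil; apply/permP=> i.
  by rewrite perm1 fixs.
pose k : 'I_9 := Ordinal n9; pose j := s k.
have le_jn : j <= n.
  rewrite leqNgt; apply/negP=> lt_nj; have := fixs j lt_nj.
  by move/perm_inj => jk; rewrite jk ltnn in lt_nj.
have [w' w'n ej] : exists2 w, all (fun x => 0 < x < n.+1) w & tperm j k = star_perm w.
  pose u (i : 'I_9) := if val i == 0 then [::] else [:: val i].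
  have eu i : star_perm (u i) = tperm ord0 i.
    rewrite /u /star_perm; case: eqP => [i0|_].
      rewrite big_nil; have -> : i = ord0 by apply: val_inj.
      by rewrite tperm1.
    by rewrite big_seq1 /star inord_val.
  have un (i : 'I_9) : i <= n -> all (fun x => 0 < x < n.+1) (u i).
    by rewrite /u; case: eqP => //= /eqP; rewrite -lt0n andbT ltnS => -> ->.
  have [-> |nejk] := eqVneq j k.
    by exists [::]; rewrite // /star_perm big_nil tperm1.
  have [j0|j0] := eqVneq j ord0.
    by exists (u k); rewrite ?un // eu j0.
  (* The transposition (j k) is the conjugate (0 j)(0 k)(0 j). *)
  exists (u j ++ u k ++ u j); first by rewrite !all_cat !un.
  rewrite !star_perm_cat !eu -[X in (X * _)%g]tpermV -conjgE tpermJ tpermL.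
  rewrite tpermD //.
  apply: contra j0 => /eqP k0; rewrite -val_eqE /= -leqn0.
  by apply: leq_trans le_jn _; rewrite -[n]/(val k) -k0.
have [|w wn es] := IH (s * tperm j k)%g (ltnW n9).
  move=> i le_ni; rewrite permM; have [eik|neik] := eqVneq i k.
    by rewrite eik -/j tpermL.
  have lt_ni : n < i by rewrite ltn_neqAle le_ni andbT eq_sym.
  rewrite fixs // tpermD //; last by rewrite eq_sym.
  by apply: contraTneq lt_ni => <-; rewrite -leqNgt.
exists (w ++ w').
  rewrite all_cat w'n andbT; apply: sub_all wn => x /andP[-> /=]; exact: ltnW.
by rewrite star_perm_cat -es -ej -mulgA tperm2 mulg1.
Qed.

Lemma even_star_perm (n : nat) (s : 'S_9) :
    n <= 9 -> (forall i : 'I_9, n <= i -> s i = i) -> s \in ('Alt_('I_9))%g ->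
  exists2 w, even_word n w & s = star_perm w.
Proof.
move=> n9 fixs; have [w wn ->] := star_perm_gen n9 fixs; rewrite Alt_even.
rewrite odd_star_perm => [ew|]; first by exists w; rewrite // /even_word wn.
by apply: sub_all wn => x /andP[-> /=] /leq_trans; apply.
Qed.

Lemma star_perm_Alt (n : nat) (w : seq nat) :
  n <= 9 -> even_word n w -> star_perm w \in ('Alt_('I_9))%g.
Proof.
move=> n9 /andP[wn ew]; rewrite Alt_even odd_star_perm //.
by apply: sub_all wn => x /andP[-> /=] /leq_trans; apply.
Qed.

Lemma star_fix (n x : nat) (i : 'I_9) :
  n <= i -> 0 < x < n -> star x i = i.
Proof.
move=> le_ni /andP[x0 xn]; have lt_xi := leq_trans xn le_ni.
rewrite tpermD // -val_eqE /=; first by rewrite neq_ltn (leq_ltn_trans _ lt_xi).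
by rewrite inordK ?neq_ltn ?lt_xi //; apply: ltn_trans (ltn_ord i).
Qed.

(** * Extended Hamming codes on eight of nine points *)

Definition bit (a : N) (i : nat) : bool := N.testbit a (N.of_nat i).

Fixpoint of_bits (bs : seq bool) : N :=
  if bs is b :: bs' then
    (if b then N.succ_double else N.double) (of_bits bs')
  else 0%num.

Lemma bit_of_bits (bs : seq bool) (i : nat) : bit (of_bits bs) i = nth false bs i.
Proof.
elim: bs i => [|b bs IH] [|i] //=; rewrite /bit.
  by case: b; case: of_bits.
rewrite Nnat.Nat2N.inj_succ -IH; case: b; rewrite ?N.succ_double_spec ?N.double_spec.
  by rewrite N.testbit_odd_succ //; apply: N.le_0_l.
by rewrite N.testbit_even_succ //; apply: N.le_0_l.
Qed.

Fixpoint all_bits (n : nat) (P : seq bool -> bool) : bool :=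
  if n is n'.+1 then
    all_bits n' (fun bs => P (false :: bs)) && all_bits n' (fun bs => P (true :: bs))
  else P [::].

Lemma all_bitsP (n : nat) (P : seq bool -> bool) :
  all_bits n P -> forall bs, size bs = n -> P bs.
Proof.
elim: n P => [|n IH] P /=; first by move=> ? [].
by case/andP=> P0 P1 [|[] bs] //= [szn]; [apply: IH P1 _ _ | apply: IH P0 _ _].
Qed.

Lemma of_bits_check : all_bits 8 (fun bs => of_bits bs \in codes).
Proof. by vm_compute. Qed.

(* A tabloid is identified with the 4-subset of {0, .., 8} in its second row,
   given by its 9 membership bits. *)
Definition parity (bs : seq bool) (c : seq nat) : bool :=
  odd (count (nth false bs) c).

(* A 4-set is a codeword of the j-th extended Hamming code when it meets each
   of the sets in the j-th line evenly; the singleton is the point which is not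
   a coordinate of the code. *)
Definition hamming_checks : seq (seq (seq nat)) :=
  [:: [:: [:: 7]; [:: 1; 2; 3; 4]; [:: 0; 1; 2; 5]; [:: 0; 2; 3; 6]];
      [:: [:: 7]; [:: 0; 2; 3; 4]; [:: 1; 2; 3; 5]; [:: 0; 1; 2; 6]];
      [:: [:: 7]; [:: 0; 1; 2; 3]; [:: 1; 2; 4; 5]; [:: 0; 2; 4; 6]];
      [:: [:: 7]; [:: 0; 1; 2; 3]; [:: 0; 2; 4; 5]; [:: 0; 1; 4; 6]];
      [:: [:: 8]; [:: 0; 1; 2; 4]; [:: 1; 2; 3; 5]; [:: 0; 2; 3; 6]];
      [:: [:: 8]; [:: 0; 2; 3; 4]; [:: 0; 1; 2; 5]; [:: 1; 2; 3; 6]];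
      [:: [:: 8]; [:: 0; 1; 2; 3]; [:: 1; 2; 4; 5]; [:: 0; 1; 4; 6]];
      [:: [:: 8]; [:: 0; 1; 2; 3]; [:: 0; 1; 4; 5]; [:: 0; 2; 4; 6]]].

Definition swap0 (x : nat) (bs : seq bool) : seq bool :=
  set_nth false (set_nth false bs 0 (nth false bs x)) x (nth false bs 0).

Definition code_coords (bs : seq bool) : N :=
  of_bits [seq ~~ has (parity bs) c | c <- hamming_checks].

(* The codes of the second half are the images of those of the first half under
   the transposition (0 1). *)
Definition spin_coords (bs : seq bool) : N * N :=
  (code_coords bs, code_coords (swap0 1 bs)).

Definition term (c : seq nat) (a b : N) : seq nat * (N * N) := (c, (a, b)).

(* The failure of [spin_coords] to commute with (0 x), as a polynomial of degree
   at most 2 in the membership bits. *)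
Definition defect (x : nat) : seq (seq nat * (N * N)) :=
  match x with
  | 2 => [:: term [::] 183 72; term [:: 0] 51 51; term [:: 2] 33 18;
            term [:: 4] 133 89; term [:: 5] 150 123; term [:: 6] 164 106;
            term [:: 7] 167 104; term [:: 8] 149 89; term [:: 0; 7] 3 3;
            term [:: 0; 8] 16 32; term [:: 1; 8] 32 16; term [:: 2; 7] 1 2;
            term [:: 3; 8] 32 16; term [:: 4; 7] 5 9; term [:: 4; 8] 160 64;
            term [:: 5; 7] 6 11; term [:: 5; 8] 176 96; term [:: 6; 7] 4 10;
            term [:: 6; 8] 128 112; term [:: 7; 8] 133 121]
  | 3 => [:: term [::] 105 150; term [:: 2] 33 18; term [:: 4] 105 150;
            term [:: 5] 105 150; term [:: 6] 105 150; term [:: 7] 73 134;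
            term [:: 8] 72 132; term [:: 0; 8] 32 16; term [:: 1; 8] 32 16;
            term [:: 2; 7] 1 2; term [:: 3; 8] 32 16; term [:: 4; 7] 9 6;
            term [:: 4; 8] 64 128; term [:: 5; 7] 9 6; term [:: 5; 8] 64 128;
            term [:: 6; 7] 9 6; term [:: 6; 8] 64 128; term [:: 7; 8] 104 148]
  | 4 => [:: term [::] 40 215; term [:: 0] 170 65; term [:: 1] 190 85;
            term [:: 2] 144 128; term [:: 4] 60 195; term [:: 5] 20 150;
            term [:: 6] 170 195; term [:: 7] 6 2; term [:: 8] 182 82;
            term [:: 0; 7] 4 4; term [:: 0; 8] 48 192; term [:: 1; 8] 32 208;
            term [:: 2; 7] 14 5; term [:: 3; 7] 14 5; term [:: 3; 8] 144 128;
            term [:: 4; 7] 2 6; term [:: 4; 8] 160 64; term [:: 5; 7] 10 3;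
            term [:: 5; 8] 128 16; term [:: 6; 7] 4 6; term [:: 6; 8] 48 64;
            term [:: 7; 8] 152 135]
  | 5 => [:: term [::] 150 105; term [:: 0] 0 150; term [:: 1] 105 255;
            term [:: 2] 204 237; term [:: 4] 215 85; term [:: 5] 255 0;
            term [:: 6] 190 170; term [:: 7] 63 118; term [:: 8] 83 139;
            term [:: 0; 7] 9 9; term [:: 0; 8] 192 112; term [:: 1; 8] 160 16;
            term [:: 2; 7] 5 2; term [:: 3; 7] 9 15; term [:: 3; 8] 192 224;
            term [:: 4; 7] 14 10; term [:: 4; 8] 16 176; term [:: 5; 7] 6 15;
            term [:: 5; 8] 48 224; term [:: 6; 7] 7 5; term [:: 6; 8] 112 64;
            term [:: 7; 8] 250 148]
  | 6 => [:: term [::] 65 190; term [:: 0] 85 40; term [:: 1] 215 170;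
            term [:: 2] 6 4; term [:: 4] 85 60; term [:: 5] 130 150;
            term [:: 6] 195 60; term [:: 7] 150 20; term [:: 8] 64 176;
            term [:: 0; 7] 2 2; term [:: 0; 8] 80 32; term [:: 1; 8] 208 160;
            term [:: 2; 7] 1 14; term [:: 3; 7] 7 10; term [:: 4; 7] 2 6;
            term [:: 4; 8] 80 48; term [:: 5; 7] 5 12; term [:: 5; 8] 128 144;
            term [:: 6; 7] 4 6; term [:: 6; 8] 192 48; term [:: 7; 8] 151 26]
  | 7 => [:: term [::] 215 40; term [:: 0] 204 204; term [:: 1] 8 12;
            term [:: 2] 94 111; term [:: 4] 84 102; term [:: 5] 150 235;
            term [:: 6] 26 171; term [:: 7] 68 141; term [:: 8] 140 64;
            term [:: 0; 1] 14 8; term [:: 0; 3] 6 4; term [:: 0; 4] 6 1;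
            term [:: 0; 5] 0 4; term [:: 0; 7] 11 15; term [:: 0; 8] 155 169;
            term [:: 1; 2] 8 12; term [:: 1; 3] 13 11; term [:: 1; 4] 10 9;
            term [:: 1; 6] 8 12; term [:: 1; 8] 92 106; term [:: 2; 4] 1 15;
            term [:: 2; 6] 14 1; term [:: 2; 7] 4 1; term [:: 3; 4] 14 1;
            term [:: 3; 6] 4 8; term [:: 3; 7] 8 12; term [:: 3; 8] 84 102;
            term [:: 4; 6] 2 5; term [:: 4; 7] 10 12; term [:: 4; 8] 2 5;
            term [:: 5; 6] 7 2; term [:: 5; 7] 8 1; term [:: 5; 8] 196 128;
            term [:: 6; 7] 4 1; term [:: 6; 8] 68 196; term [:: 7; 8] 25 225]
  | 8 => [:: term [::] 190 65; term [:: 0] 204 204; term [:: 1] 64 192;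
            term [:: 2] 218 249; term [:: 4] 226 101; term [:: 5] 150 125;
            term [:: 6] 26 185; term [:: 7] 14 81; term [:: 8] 8 196;
            term [:: 0; 1] 208 64; term [:: 0; 3] 144 128; term [:: 0; 4] 176 16;
            term [:: 0; 5] 0 128; term [:: 0; 7] 188 60; term [:: 0; 8] 240 208;
            term [:: 1; 2] 64 192; term [:: 1; 3] 224 112; term [:: 1; 4] 240 208;
            term [:: 1; 6] 192 64; term [:: 1; 8] 128 32; term [:: 2; 4] 96 48;
            term [:: 2; 6] 176 208; term [:: 2; 7] 202 89; term [:: 3; 4] 48 80;
            term [:: 3; 6] 64 0; term [:: 3; 7] 64 192; term [:: 3; 8] 192 224;
            term [:: 4; 6] 48 144; term [:: 4; 7] 242 197; term [:: 4; 8] 176 16;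
            term [:: 5; 6] 144 32; term [:: 5; 7] 70 93; term [:: 5; 8] 192 0;
            term [:: 6; 7] 74 217; term [:: 6; 8] 64 192; term [:: 7; 8] 40 84]
  | _ => [::]
  end.

Definition monomial (c : seq nat) (bs : seq bool) : bool :=
  all (nth false bs) c.

Definition eval_poly (p : seq (seq nat * (N * N))) (bs : seq bool) : N * N :=
  foldr (fun t => xor2 (if monomial t.1 bs then t.2 else (0, 0)%num)) (0, 0)%num p.

(** The second rows of the tabloids in the polytabloid of the identity tableau, whose columns are
    {k, k + 5} for k < 4 and {4}. *)
Definition transversal (bs : seq bool) : bool :=
  ~~ nth false bs 4 &&
  all (fun k => nth false bs k (+) nth false bs (k + 5)) (iota 0 4).

(* On 4-subsets, [transversal] is a linear function of the coordinates, with these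
   coefficients, plus the sum of the monomials in [transversal_defect]. *)
Definition transversal_coords : seq N * seq N :=
  ([:: 0; 0; 1; 0; 0; 0; 1; 1]%num,
   [:: 1; 1; 0; 0; 1; 0; 1; 1]%num).

Definition transversal_defect : seq (seq nat) :=
  [:: [:: 0]; [:: 1]; [:: 3]; [:: 8]; [:: 0; 5]; [:: 1; 6]; [:: 2; 3];
      [:: 2; 4]; [:: 3; 4]; [:: 3; 7]; [:: 5; 7]; [:: 6; 7]].

Lemma weight4P (P : seq bool -> bool) (bs : seq bool) :
  all_bits 9 (fun bs => (count id bs == 4) ==> P bs) ->
  size bs = 9 -> count id bs = 4 -> P bs.
Proof. by move=> /all_bitsP H /H /implyP H' /eqP. Qed.

Lemma defect_check :
  all (fun x => all_bits 9 (fun bs => (count id bs == 4) ==>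
    (spin_coords (swap0 x bs) ==
       xor2 (swap2 x (spin_coords bs)) (eval_poly (defect x) bs)))) (iota 1 8).
Proof. by vm_compute. Qed.

(** Degree less than 4 is what makes the defect vanish on the Specht module. *)
Lemma size_defect (x : nat) : all (fun t => size t.1 < 4) (defect x).
Proof. by do 9?[case: x => [|x] //]. Qed.

(** Modulo monomials of degree less than 4, the pairing with the generating polytabloid is a
    function of the Hamming coordinates. *)
Lemma transversal_check :
  all_bits 9 (fun bs => (count id bs == 4) ==> (transversal bs ==
    bit (N.lxor (mulN transversal_coords.1 (spin_coords bs).1)
                (mulN transversal_coords.2 (spin_coords bs).2)) 0 (+)
    odd (count (monomial^~ bs) transversal_defect))).
Proof. by vm_compute. Qed.

Import GRing.Theory.
Local Open Scope ring_scope.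

(** * Vectors over 'F_2 *)

Definition bits_row (n : nat) (a : N) : 'rV['F_2]_n := \row_j (bit a j)%:R.

Lemma F2_double (a : 'F_2) : a + a = 0.
Proof. by rewrite -mulr2n -mulr_natl (_ : 2%:R = 0) ?mul0r //; apply/eqP. Qed.

Lemma F2_addrr (n : nat) (v : 'rV['F_2]_n) : v + v = 0.
Proof. by apply/rowP=> j; rewrite !mxE F2_double. Qed.

Lemma natr_F2_addb (b c : bool) : (b (+) c)%:R = b%:R + c%:R :> 'F_2.
Proof. by case: b; case: c; apply/eqP. Qed.

Lemma bits_row0 (n : nat) : bits_row n 0 = 0.
Proof. by apply/rowP=> j; rewrite !mxE. Qed.

Lemma bits_row_lxor (n : nat) (a b : N) :
  bits_row n (N.lxor a b) = bits_row n a + bits_row n b.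
Proof.
apply/rowP=> j; rewrite !mxE /bit N.lxor_spec -natr_F2_addb.
by do 2!case: N.testbit.
Qed.

Definition rows_mx (n : nat) (rows : seq N) : 'M['F_2]_(8, n) :=
  \matrix_(i < 8) bits_row n (nth 0%num rows i).

(** [m] is left free because each step of the induction consumes one row. *)
Lemma bits_row_mulN_sum (n m : nat) (rows : seq N) (a : N) :
  (size rows <= m)%N ->
  bits_row n (mulN rows a) =
    \sum_(i < m) (bit a i)%:R *: bits_row n (nth 0%num rows i).
Proof.
elim: rows m a => [|r rows IH] m a.
  move=> _; rewrite bits_row0 big1 // => i _.
  by rewrite nth_default // bits_row0 scaler0.
case: m => // m szm; rewrite big_ord_recl /= bits_row_lxor (IH m) //; congr (_ + _).
  rewrite /bit N.bit0_odd; case: N.odd; rewrite ?scale1r // bits_row0.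
  by rewrite scale0r.
apply: eq_bigr => i _; congr (_%:R *: _); rewrite /bit N.div2_spec.
by rewrite N.shiftr_spec' Nnat.Nat2N.inj_succ N.add_1_r.
Qed.

Lemma bits_row_mulN (n : nat) (rows : seq N) (a : N) :
  (size rows <= 8)%N ->
  bits_row n (mulN rows a) = bits_row 8 a *m rows_mx n rows.
Proof.
move=> sz; rewrite (bits_row_mulN_sum n a sz) mulmx_sum_row.
by apply: eq_bigr => i _; rewrite mxE rowK.
Qed.

Lemma bits_row_onto (v : 'rV['F_2]_8) : exists2 a, a \in codes & v = bits_row 8 a.
Proof.
pose bs := [seq v 0 j != 0 | j <- enum 'I_8].
have szbs : size bs = 8 by rewrite size_map size_enum_ord.
exists (of_bits bs); first exact: (all_bitsP of_bits_check).
apply/rowP=> j; rewrite mxE bit_of_bits (nth_map ord0) ?size_enum_ord //.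
by rewrite nth_ord_enum; case: (v 0 j) => [[|[|]]] // *; apply/val_inj.
Qed.

Lemma bits_row_inj_check :
  all (fun a => (a == 0%num) || has (bit a) (iota 0 8)) codes.
Proof. by vm_compute. Qed.

Lemma bits_row_eq0 (a : N) : a \in codes -> bits_row 8 a = 0 -> a = 0%num.
Proof.
move=> ca /rowP a0; have /allP/(_ a ca)/orP[/eqP //|/hasP[i]] := bits_row_inj_check.
by rewrite mem_iota => /andP[_ lti] ai; have := a0 (Ordinal lti); rewrite !mxE ai.
Qed.

Lemma low_codes_check :
  all (fun a => (a \in low_codes) == ~~ has (bit a) (iota 4 4)) codes.
Proof. by vm_compute. Qed.

Lemma low_codesE (a : N) :
  a \in codes -> (bits_row 8 a <= (pid_mx 4 : 'M_8))%MS = (a \in low_codes).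
Proof.
move=> ca; have /allP/(_ a ca)/eqP-> := low_codes_check.
apply/idP/idP=> [/submxP[c /rowP eq_c]|/hasPn high0].
  apply/hasPn=> i; rewrite mem_iota => /andP[le4i lti8].
  have := eq_c (Ordinal lti8); rewrite !mxE big1 => [|j _].
    by case: bit.
  by rewrite !mxE /=; case: eqP => [->|_] /=; rewrite ?[(i < 4)%N]ltnNge ?le4i mulr0.
suff -> : bits_row 8 a = bits_row 8 a *m pid_mx 4 by apply: submxMl.
apply/rowP=> j; rewrite [RHS]mxE (bigD1 j) //= big1 => [|i neij]; rewrite !mxE.
  rewrite addr0 eqxx /=; have [_|le4j] := ltnP j 4; first by rewrite mulr1.
  rewrite mulr0 (negPf (high0 j _)) // mem_iota le4j; exact: ltn_ord.
by rewrite (_ : (i == j :> nat) = false) ?mulr0 //; apply/eqP=> /val_inj; apply/eqP.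
Qed.

Definition pair_row (u : N * N) : 'rV['F_2]_(8 + 8) :=
  row_mx (bits_row 8 u.1) (bits_row 8 u.2).

Definition swap_mx (x : nat) : 'M['F_2]_(8 + 8) :=
  block_mx 0 (rows_mx 8 (rows01 x)) (rows_mx 8 (rows10 x)) 0.

Lemma pair_row_xor2 (u v : N * N) : pair_row (xor2 u v) = pair_row u + pair_row v.
Proof. by rewrite /pair_row !bits_row_lxor add_row_mx. Qed.

Lemma pair_row_swap2 (x : nat) (u : N * N) :
  pair_row (swap2 x u) = pair_row u *m swap_mx x.
Proof.
rewrite /pair_row /swap2 /= mul_row_block !mulmx0 add0r addr0.
by rewrite !bits_row_mulN // -?[rows01 _]/(half_rows false _)
  -?[rows10 _]/(half_rows true _) size_half_rows.
Qed.

Lemma pair_row_onto (v : 'rV['F_2]_(8 + 8)) :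
  exists a b, [/\ a \in codes, b \in codes & v = pair_row (a, b)].
Proof.
have [a ca ea] := bits_row_onto (lsubmx v); have [b cb eb] := bits_row_onto (rsubmx v).
by exists a, b; split; rewrite // /pair_row /= -ea -eb hsubmxK.
Qed.

(** * Hamming coordinates on the Specht module *)

Local Notation la54 := [:: 5; 4]%N.
Local Notation tabs := (tabloids 9 la54).

Lemma row54E (k : nat) : (k < 9)%N -> reshape_index la54 k = (5 <= k)%N.
Proof. by do 9?[case: k => [|k] //]. Qed.

(** In reading order the cells 0 to 4 form the first row, and 5 to 8 the second row, below the cells
    0 to 3. *)
Definition column (k : nat) : nat := if (k < 5)%N then k else (k - 5)%N.

Lemma column54E (k : nat) : (k < 9)%N -> reshape_offset la54 k = column k.
Proof. by do 9?[case: k => [|k] //]. Qed.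

(** The tableaux in a tabloid have the same rows, so any representative gives these bits. *)
Definition tab_bits (T : {set 'S_9}) : seq bool :=
  [seq tab_row la54 (repr T) x == 1%N | x <- enum 'I_9].

Lemma size_tab_bits (T : {set 'S_9}) : size (tab_bits T) = 9%N.
Proof. by rewrite size_map size_enum_ord. Qed.

Lemma tab_bitsE (s : 'S_9) :
  tab_bits (tabloid la54 s) = [seq (5 <= s^-1%g x)%N | x : 'I_9 <- enum 'I_9].
Proof.
apply: eq_map => x.
have : repr (tabloid la54 s) \in tabloid la54 s.
  by apply: (mem_repr s); rewrite inE; apply/forallP.
rewrite inE => /forallP/(_ x)/eqP->; rewrite /tab_row row54E //.
by case: leq.
Qed.

Lemma nth_tab_bits (s : 'S_9) (x : 'I_9) :
  nth false (tab_bits (tabloid la54 s)) x = (5 <= s^-1%g x)%N.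
Proof. by rewrite tab_bitsE (nth_map ord0) ?size_enum_ord // nth_ord_enum. Qed.

Lemma count_tab_bits (s : 'S_9) : count id (tab_bits (tabloid la54 s)) = 4%N.
Proof.
rewrite tab_bitsE count_map -sum1_count big_enum_cond /= (reindex_inj (@perm_inj _ s)).
under eq_bigl => x do rewrite permK.
by rewrite big_mkcond !big_ord_recl big_ord0.
Qed.

Lemma nth_swap0 (x y : nat) (bs : seq bool) :
  size bs = 9%N -> (x < 9)%N ->
  nth false (swap0 x bs) y =
    nth false bs (if y == x then 0%N else if y == 0%N then x else y).
Proof.
move=> sz lt_x9; rewrite nth_set_nth /= eq_sym; case: eqP => // _.
by rewrite nth_set_nth /=; case: eqP.
Qed.

Lemma size_swap0 (x : nat) (bs : seq bool) :
  size bs = 9%N -> (x < 9)%N -> size (swap0 x bs) = 9%N.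
Proof. by move=> sz lt_x9; rewrite !size_set_nth sz; apply/maxn_idPr. Qed.

Lemma tab_bits_star (s : 'S_9) (x : nat) :
  (0 < x < 9)%N ->
  tab_bits (tabloid la54 s :* star x)%g = swap0 x (tab_bits (tabloid la54 s)).
Proof.
case/andP=> x0 lt_x9; apply: (@eq_from_nth _ false).
  by rewrite size_swap0 ?size_tab_bits.
move=> i; rewrite size_tab_bits => lti.
rewrite nth_swap0 ?size_tab_bits // tabloidM -[i]/(val (Ordinal lti)) nth_tab_bits.
rewrite invMg permM /star tpermV.
case: tpermP => [/(congr1 val)/= ->|/(congr1 val) /= |ne1 ne2].
- rewrite eq_sym eqn0Ngt x0 /= -{2}[x](inordK (n' := 8)) //.
  by rewrite nth_tab_bits.
- rewrite inordK // => ->; rewrite eqxx.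
  by rewrite -[0%N]/(val (ord0 : 'I_9)) nth_tab_bits.
rewrite !ifN ?nth_tab_bits //.
  by apply/eqP=> i0; apply: ne1; apply: val_inj.
by apply/eqP=> ix; apply: ne2; apply: val_inj; rewrite /= inordK.
Qed.

Lemma tabs_enumP (i : 'I_#|tabs|) : exists s, enum_val i = tabloid la54 s.
Proof. by have /imsetP[s _ ->] := enum_valP i; exists s. Qed.

Definition bits_col (f : seq bool -> bool) : 'cV['F_2]_#|tabs| :=
  \col_i (f (tab_bits (enum_val i)))%:R.

Definition coords_mx : 'M['F_2]_(#|tabs|, 8 + 8) :=
  \matrix_i pair_row (spin_coords (tab_bits (enum_val i))).

Local Notation mxtab := (@tabloid_mx 'F_2 9 la54).
Local Notation spechtF := (specht 'F_2 9 la54).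
Local Notation polytab := (@polytabloid 'F_2 9 la54).
Local Notation tabvec := (@tabloid_vec 'F_2 9 la54).

Lemma tabvec_mul (m : nat) (f : seq bool -> 'rV['F_2]_m) (s : 'S_9) :
  tabvec (tabloid la54 s) *m (\matrix_i f (tab_bits (enum_val i))) =
    f (tab_bits (tabloid la54 s)).
Proof.
have Tt : tabloid la54 s \in tabs by apply: imset_f.
rewrite mulmx_sum_row (bigD1 (enum_rank_in Tt (tabloid la54 s))) //=.
rewrite rowK mxE enum_rankK_in // eqxx scale1r.
rewrite big1 ?addr0 // => i nei; rewrite mxE; case: eqP => [eT|]; last first.
  by rewrite scale0r.
by case/eqP: nei; apply: enum_val_inj; rewrite enum_rankK_in.
Qed.

Lemma tabvec_bits_col (f : seq bool -> bool) (s : 'S_9) :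
  tabvec (tabloid la54 s) *m bits_col f =
    const_mx (f (tab_bits (tabloid la54 s)))%:R.
Proof.
rewrite -(tabvec_mul (fun bs => const_mx (f bs)%:R)); congr (_ *m _).
by apply/matrixP=> i j; rewrite !mxE.
Qed.

Lemma F2_sign (b : bool) : (-1) ^+ b = 1 :> 'F_2.
Proof. by case: b; apply/eqP. Qed.

Lemma polytabE (s : 'S_9) :
  polytab s = \sum_(p in col_stab la54 s) tabvec (tabloid la54 (s * p)%g).
Proof. by apply: eq_bigr => p _; rewrite F2_sign scale1r. Qed.

Lemma tab_bits_fixed (s t : 'S_9) (c : seq nat) :
  (forall x : 'I_9, val x \in c -> t x = x) ->
  monomial c (tab_bits (tabloid la54 (s * t)%g)) =
    monomial c (tab_bits (tabloid la54 s)).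
Proof.
move=> fixc; apply: eq_in_all => i ci.
have [lti|le9i] := ltnP i 9; last by rewrite !nth_default ?size_tab_bits.
rewrite -[i]/(val (Ordinal lti)) !nth_tab_bits invMg permM.
by rewrite (canLR (permK t) (esym (fixc _ _))).
Qed.

(* Fewer than four points miss some column of the tableau, and transposing that
   column matches the terms of the polytabloid in pairs. *)
Lemma polytab_monomial (s : 'S_9) (c : seq nat) :
  (size c < 4)%N -> polytab s *m bits_col (monomial c) = 0.
Proof.
move=> szc; pose cols := [seq column (s^-1%g (inord i)) | i <- c].
have /allPn[k] : ~~ all (mem cols) (iota 0 4).
  apply: contraL szc => /allP sub_cols; rewrite -leqNgt.
  by have := uniq_leq_size (iota_uniq 0 4) sub_cols; rewrite size_map.
rewrite mem_iota add0n => /andP[_ lt_k4] kcols.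
have lt_k9 : (k < 9)%N by apply: ltn_trans lt_k4 _.
have lt_k59 : (k + 5 < 9)%N by rewrite addnC -ltn_subRL.
pose x0 := s (Ordinal lt_k9); pose x1 := s (Ordinal lt_k59).
have col_k5 : column (k + 5) = k by rewrite /column ltnNge leq_addl addnK.
have col_k : column k = k by rewrite /column (leq_trans lt_k4).
have ne_x01 : x0 != x1.
  by rewrite (inj_eq perm_inj) -val_eqE /= -{1}[k]addn0 eqn_add2l.
pose t := tperm x0 x1.
have fixc x : val x \in c -> t x = x.
  move=> cx; have nek : column (s^-1%g x) != k.
    apply: contraNneq kcols => <-; apply/mapP; exists (val x) => //.
    by rewrite inord_val.
  rewrite tpermD //; apply: contraNneq nek => <-; rewrite permK /=.
    exact/eqP.
  exact/eqP.
have col_t x : tab_col la54 s (t x) = tab_col la54 s x.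
  rewrite /tab_col !column54E //; case: tpermP => // ->; rewrite !permK /=.
    by rewrite col_k col_k5.
  by rewrite col_k col_k5.
have stab_t p : ((p * t)%g \in col_stab la54 s) = (p \in col_stab la54 s).
  by rewrite !inE; apply: eq_forallb => x; rewrite permM col_t.
(* Right multiplication by [t] preserves the column stabilizer and changes the parity, so the even
   terms repeat the odd ones and cancel them in characteristic 2. *)
rewrite polytabE mulmx_suml (bigID (@odd_perm _)) /=.
rewrite [X in _ + X](reindex_inj (mulIg t)) /=.
rewrite [X in _ + X](eq_big (fun p => (p \in col_stab la54 s) && odd_perm p)
  (fun p => tabvec (tabloid la54 (s * p)%g) *m bits_col (monomial c))).
- exact: F2_addrr.
- by move=> p; rewrite stab_t odd_permM odd_tperm ne_x01 addbT negbK.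
move=> p _; by rewrite !tabvec_bits_col mulgA (tab_bits_fixed _ fixc).
Qed.

Lemma specht_monomial (m : nat) (u : 'M_(m, #|tabs|)) (c : seq nat) :
  (size c < 4)%N -> (u <= spechtF)%MS -> u *m bits_col (monomial c) = 0.
Proof.
move=> szc su; apply/sub_kermxP/(submx_trans su)/sumsmx_subP => s _.
by rewrite genmxE; apply/sub_kermxP/polytab_monomial.
Qed.

Lemma eval_polyE (p : seq (seq nat * (N * N))) (bs : seq bool) :
  pair_row (eval_poly p bs) = \sum_(t <- p) (monomial t.1 bs)%:R *: pair_row t.2.
Proof.
elim: p => [|t p IH]; first by rewrite big_nil /pair_row !bits_row0 row_mx0.
rewrite big_cons /= pair_row_xor2 IH; case: monomial; rewrite ?scale1r //.
by rewrite scale0r /pair_row !bits_row0 row_mx0.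
Qed.

(** On the whole permutation module the two sides differ by the defect, which [specht_monomial]
    annihilates on the Specht module. *)
Lemma specht_coords_star (m : nat) (u : 'M_(m, #|tabs|)) (x : nat) :
  (0 < x < 9)%N -> (u <= spechtF)%MS ->
  u *m mxtab (star x) *m coords_mx = u *m coords_mx *m swap_mx x.
Proof.
move=> xn su.
have -> : u *m mxtab (star x) *m coords_mx = u *m (mxtab (star x) *m coords_mx).
  by rewrite mulmxA.
have -> : mxtab (star x) *m coords_mx = coords_mx *m swap_mx x +
    \sum_(t <- defect x) bits_col (monomial t.1) *m pair_row t.2.
  apply/row_matrixP=> i; have [s es] := tabs_enumP i.
  rewrite raddfD raddf_sum row_mul rowK es tabloidM.
  rewrite (tabvec_mul (fun bs => pair_row (spin_coords bs))) -tabloidM.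
  rewrite tab_bits_star //= row_mul rowK es.
  have /allP/(_ x) := defect_check; rewrite mem_iota => /(_ xn).
  move/weight4P/(_ (size_tab_bits _) (count_tab_bits s))/eqP->.
  rewrite pair_row_xor2 pair_row_swap2 eval_polyE; congr (_ + _).
  apply: eq_bigr => t _; rewrite row_mul; apply/rowP=> j.
  by rewrite !mxE big_ord1 !mxE es.
rewrite mulmxDr mulmxA mulmx_sumr big_seq big1 ?addr0 // => t dt.
by rewrite mulmxA specht_monomial ?mul0mx //; apply: (allP (size_defect x)).
Qed.

(** * The polytabloid of the identity tableau and the radical *)

Local Notation stab1 := (col_stab la54 (1%g : 'S_9)).

Lemma col_stab1P (p : 'S_9) :
  reflect (forall x : 'I_9, column (p x) = column x) (p \in stab1).
Proof.
rewrite inE; apply: (iffP forallP) => H x; have := H x.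
  by rewrite /tab_col invg1 !perm1 !column54E // => /eqP.
by rewrite /tab_col invg1 !perm1 !column54E // => ->.
Qed.

Lemma column_inj (x y : 'I_9) :
  column x = column y -> (5 <= x)%N = (5 <= y)%N -> x = y.
Proof.
move=> exy le5; apply: val_inj; move: exy le5; rewrite /column /=.
by case: (ltnP x 5) => ?; case: (ltnP y 5) => ?; lia.
Qed.

Lemma column_invg (p : 'S_9) (x : 'I_9) :
  p \in stab1 -> column (p^-1%g x) = column x.
Proof. by move=> /col_stab1P/(_ (p^-1%g x)); rewrite permKV. Qed.

(** A cell is determined by its column and its row, and the tabloid gives the rows. *)
Lemma col_stab1_tabloid_inj : {in stab1 &, injective (@tabloid 9 la54)}.
Proof.
move=> p q Cp Cq epq; apply/invg_inj/permP => x.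
apply: column_inj; first by rewrite !column_invg.
by rewrite -!nth_tab_bits epq.
Qed.

Lemma transversal_col_stab (p : 'S_9) :
  p \in stab1 -> transversal (tab_bits (tabloid la54 p)).
Proof.
move=> Cp; apply/andP; split.
  (* The cell 4 is alone in its column, so the point 4 stays in the first row. *)
  have := nth_tab_bits p (Ordinal (isT : (4 < 9)%N)).
  have := column_invg (Ordinal (isT : (4 < 9)%N)) Cp.
  move: (p^-1%g _) => y; rewrite /column /= => + ->; have := ltn_ord y.
  by case: (ltnP y 5) => ?; lia.
apply/allP=> k; rewrite mem_iota add0n => /andP[_ lt_k4].
have lt_k9 : (k < 9)%N by lia.
have lt_k59 : (k + 5 < 9)%N by lia.
have := nth_tab_bits p (Ordinal lt_k9); have := nth_tab_bits p (Ordinal lt_k59).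
move=> /= -> ->.
have := column_invg (Ordinal lt_k9) Cp; have := column_invg (Ordinal lt_k59) Cp.
(* The points k and k + 5 occupy the two different cells of column k, exactly one of which is in the
   second row. *)
have : p^-1%g (Ordinal lt_k9) <> p^-1%g (Ordinal lt_k59).
  by move/perm_inj/(congr1 val) => /=; lia.
move: (p^-1%g _) (p^-1%g _) => x y nexy /=; rewrite /column.
have := ltn_ord x; have := ltn_ord y.
have nexy' : val y <> val x by move/val_inj.
rewrite [(k + 5 < 5)%N]ltnNge leq_addl /= addnK (ltn_trans lt_k4) //.
move: nexy' => /=; case: (ltnP x 5) => ?; case: (ltnP y 5) => ?; rewrite /=; lia.
Qed.

Definition mate (x : nat) : nat :=
  if (x < 4)%N then (x + 5)%N else if (x == 4)%N then x else (x - 5)%N.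

Lemma mateP (x : nat) :
  (x < 9)%N -> [/\ (mate x < 9)%N, column (mate x) = column x & mate (mate x) = x].
Proof. by do 9?[case: x => [|x] //]. Qed.

(** For a transversal [bs] this is the involution in the column stabilizer whose tabloid has second
    row [bs]. *)
Definition flip (bs : seq bool) (x : 'I_9) : 'I_9 :=
  if nth false bs (column x) then inord (mate x) else x.

Lemma val_flip (bs : seq bool) (x : 'I_9) :
  val (flip bs x) = if nth false bs (column x) then mate x else x.
Proof.
have [ltm _ _] := mateP (ltn_ord x).
by rewrite /flip; case: nth => //; rewrite /= inordK.
Qed.

Lemma column_flip (bs : seq bool) (x : 'I_9) : column (flip bs x) = column x.
Proof.
have [_ em _] := mateP (ltn_ord x).
by rewrite [flip bs x : nat]val_flip; case: nth.
Qed.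

Lemma flipK (bs : seq bool) : involutive (flip bs).
Proof.
move=> x; apply: val_inj; rewrite val_flip column_flip val_flip.
by have [_ _ mm] := mateP (ltn_ord x); case: nth.
Qed.

Lemma transversal_tabloid (s : 'S_9) :
  transversal (tab_bits (tabloid la54 s)) ->
  exists2 p, p \in stab1 & tabloid la54 s = tabloid la54 p.
Proof.
set bs := tab_bits _ => /andP[b4 /allP btr].
pose p : 'S_9 := perm (inv_inj (flipK bs)).
have pE x : p x = flip bs x by rewrite permE.
have pV : p^-1%g = p.
  by apply/eqP; rewrite eq_invg_mul; apply/eqP/permP=> x; rewrite permM !pE flipK perm1.
exists p; first by apply/col_stab1P=> x; rewrite pE column_flip.
have row_eq x : (5 <= p^-1%g x)%N = nth false bs x.
  rewrite pV pE [flip bs x : nat]val_flip.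
  suff H (y : nat) : (y < 9)%N ->
      (5 <= (if nth false bs (column y) then mate y else y))%N = nth false bs y.
    exact: H.
  move: (btr 0%N isT) (btr 1%N isT) (btr 2%N isT) (btr 3%N isT) b4 => /=.
  do 9?[case: y => [|y] //=]; rewrite /column /mate /=; do !case: (nth _ _ _) => //=.
apply/setP=> t; rewrite !inE; apply: eq_forallb => x; congr (_ == _).
by rewrite /tab_row !row54E // row_eq /bs nth_tab_bits.
Qed.

(** The column stabilizer maps bijectively onto the transversal tabloids, so no terms of the
    polytabloid cancel. *)
Lemma polytab1_tr : (polytab 1)^T = bits_col transversal.
Proof.
apply/colP=> i; rewrite mxE polytabE summxE [RHS]mxE.
have [s es] := tabs_enumP i.
under eq_bigr => p Cp do rewrite mxE es mul1g.
have [tr|ntr] := boolP (transversal _).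
  have [p Cp ep] : exists2 p, p \in stab1 & tabloid la54 s = tabloid la54 p.
    by apply: transversal_tabloid; rewrite -es.
  rewrite (bigD1 p) //= ep eqxx big1 ?addr0 // => q /andP[Cq neq].
  case: eqP => // e; case/eqP: neq.
  exact/esym/(col_stab1_tabloid_inj Cp Cq e).
rewrite big1 // => p Cp; case: eqP => // ep; case/negP: ntr.
by rewrite es ep transversal_col_stab.
Qed.

Lemma natr_odd (n : nat) : (odd n)%:R = n%:R :> 'F_2.
Proof. by elim: n => // n IH; rewrite /= mulrS -IH; case: odd; apply/eqP. Qed.

Lemma bits_col_transversal :
  bits_col transversal =
    coords_mx *m col_mx (rows_mx 1 transversal_coords.1)
                        (rows_mx 1 transversal_coords.2) +
    \sum_(c <- transversal_defect) bits_col (monomial c).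
Proof.
apply/row_matrixP=> i; have [s es] := tabs_enumP i.
rewrite raddfD raddf_sum /= row_mul rowK es /pair_row mul_row_col.
rewrite -!bits_row_mulN // -bits_row_lxor; apply/rowP=> j.
rewrite !mxE summxE es ord1.
have := weight4P transversal_check (size_tab_bits _) (count_tab_bits s).
move/eqP->; rewrite natr_F2_addb natr_odd -sum1_count natr_sum; congr (_ + _).
rewrite big_mkcond; apply: eq_bigr => c _; rewrite !mxE es.
by case: monomial.
Qed.

Lemma specht_module_mul (m : nat) (u : 'M_(m, #|tabs|)) (g : 'S_9) :
  (u <= spechtF)%MS -> (u *m mxtab g <= spechtF)%MS.
Proof.
move=> su; have /mxmoduleP/(_ g (in_setT _)) := specht_module 'F_2 9 la54.
by apply: submx_trans; apply: submxMr.
Qed.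

Lemma mxtabM (g h : 'S_9) : mxtab (g * h)%g = mxtab g *m mxtab h.
Proof. exact: (repr_mxM (tabloid_repr 'F_2 9 la54)) (in_setT _) (in_setT _). Qed.

Lemma specht_coords_word (u : 'rV_#|tabs|) (w : seq nat) :
    all (fun x => (0 < x < 9)%N) w -> (u <= spechtF)%MS -> u *m coords_mx = 0 ->
  u *m mxtab (star_perm w) *m coords_mx = 0.
Proof.
elim: w u => [|x w IH] u /=.
  move=> _ _ u0; rewrite /star_perm big_nil.
  by rewrite (repr_mx1 (tabloid_repr 'F_2 9 la54)) mulmx1.
case/andP=> xn wn su u0; rewrite star_perm_cons mxtabM mulmxA.
by apply: IH; rewrite ?specht_module_mul // specht_coords_star // u0 mul0mx.
Qed.

(** Orthogonality to the Specht module is tested on the translates of one polytabloid. The kernel of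
    the coordinates is stable under all permutations, and there the pairing with that polytabloid
    reduces to monomials of low degree, which vanish. *)
Lemma specht_coords_ker (u : 'rV_#|tabs|) :
  (u <= spechtF)%MS -> u *m coords_mx = 0 -> (u <= specht_perp 'F_2 9 la54)%MS.
Proof.
move=> su u0; apply/sub_kermxP; rewrite -[u]trmxK -trmx_mul.
apply/eqP; rewrite trmx_eq0; apply/eqP/sub_kermxP/sumsmx_subP => s _.
rewrite genmxE; apply/sub_kermxP; apply/trmx_inj; rewrite trmx_mul trmxK trmx0.
(* The tabloid form is invariant, so the translation by [s] moves to [u] as its inverse. *)
rewrite -[s]mul1g -polytabloidM trmx_mul tr_tabloid_mx mulmxA polytab1_tr.
have [w wn ->] : exists2 w, all (fun x => (0 < x < 9)%N) w & s^-1%g = star_perm w.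
  by apply: star_perm_gen => // i; rewrite leqNgt ltn_ord.
have sv := specht_module_mul (star_perm w) su.
rewrite bits_col_transversal mulmxDr mulmxA specht_coords_word // mul0mx add0r.
rewrite mulmx_sumr big_seq big1 // => c cd; apply: specht_monomial sv.
by move: c cd; apply/allP.
Qed.

(** * Composition factors *)

(* [L] induces an embedding of [rV] into the quotient of [rG] by [K]. *)
Definition lifting (F : fieldType) (gT : finGroupType) (G : {group gT}) (n m : nat)
    (rG : mx_representation F G n) (rV : mx_representation F G m)
    (K : 'M[F]_n) (L : 'M[F]_(m, n)) : Prop :=
  [/\ mxmodule rG K,
      forall g, g \in G -> (L *m rG g - rV g *m L <= K)%MS
    & forall v : 'rV[F]_m, (v *m L <= K)%MS -> v = 0].

Section Liftings.

Variables (F : fieldType) (gT : finGroupType) (G : {group gT}).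

(** A section of a section is a section; the new kernel is the preimage of [K2] under the first
    lifting. *)
Lemma lifting_comp (n d m : nat) (rG : mx_representation F G n)
    (rD : mx_representation F G d) (rV : mx_representation F G m) K1 L1 K2 L2 :
  lifting rG rD K1 L1 -> lifting rD rV K2 L2 ->
  lifting rG rV (K2 *m L1 + K1)%MS (L2 *m L1).
Proof.
move=> [mod1 eqv1 inj1] [mod2 eqv2 inj2]; split.
- apply/mxmoduleP=> g Gg.
  rewrite addsmxMr addsmx_sub (submx_trans (mxmoduleP mod1 g Gg)) ?addsmxSr //.
  rewrite andbT -mulmxA; have -> : L1 *m rG g = rD g *m L1 + (L1 *m rG g - rD g *m L1).
    by rewrite addrC subrK.
  rewrite mulmxDr addmx_sub //.
    rewrite mulmxA (submx_trans _ (addsmxSl _ _)) // submxMr //.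
    exact: mxmoduleP mod2 g Gg.
  apply: submx_trans (addsmxSr _ _); apply: submx_trans (eqv1 g Gg).
  exact: submxMl.
- move=> g Gg; have -> : L2 *m L1 *m rG g - rV g *m (L2 *m L1) =
      (L2 *m rD g - rV g *m L2) *m L1 + L2 *m (L1 *m rG g - rD g *m L1).
    by rewrite mulmxBl mulmxBr !mulmxA [RHS]addrC addrA subrK.
  rewrite addmx_sub //.
    by rewrite (submx_trans _ (addsmxSl _ _)) // submxMr // eqv2.
  apply: submx_trans (addsmxSr _ _); apply: submx_trans (eqv1 g Gg).
  exact: submxMl.
move=> v /sub_addsmxP[[c1 c2] /= ev]; apply: inj2.
(* The difference of [v *m L2] and [c1 *m K2] is sent by [L1] into [K1], so it is 0. *)
apply/submxP; exists c1; apply/eqP; rewrite -subr_eq0; apply/eqP/inj1.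
by rewrite mulmxBl -!mulmxA ev addrC addKr submxMl.
Qed.

Lemma lifting_rsim (n m : nat) (rG : mx_representation F G n)
    (rV : mx_representation F G m) :
  mx_rsim rV rG -> exists B, lifting rG rV 0 B.
Proof.
case=> B _ freeB homB; exists B; split; first exact: mxmodule0.
  by move=> g Gg; rewrite homB // subrr sub0mx.
move=> v; rewrite submx0 => /eqP vB; apply: (row_free_inj freeB).
by rewrite vB mul0mx.
Qed.

(** [L] picks representatives for a basis of the section; the bound on [L] is what later keeps them
    in the Specht module. *)
Lemma lifting_section (n : nat) (rG : mx_representation F G n) (U V : 'M[F]_n)
    (modU : mxmodule rG U) (modV : mxmodule rG V) :
  exists2 L, lifting rG (section_repr modU modV) U L & (L <= U + V)%MS.
Proof.
set W := <<in_factmod U V>>%MS.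
pose L := val_factmod (val_submod (1%:M : 'M_(\rank W))).
have LE m (A : 'M_(m, \rank W)) : A *m L = val_factmod (val_submod A).
  by rewrite /L /val_factmod /val_submod /= mul1mx !mulmxA.
exists L; last first.
  apply: submx_trans (proj_factmodS U V); rewrite val_factmodS.
  by rewrite val_submod1 genmxE.
split=> // [g Gg|v].
  rewrite LE -[section_repr _ _ g]mul1mx (val_submodJ (section_module modU modV)) //.
  rewrite val_factmodJ // -{1}(add_sub_fact_mod U (L *m rG g)) addrK.
  exact: val_submodP.
rewrite LE -in_factmod_eq0 val_factmodK => /eqP v0.
by apply: (@val_submod_inj _ _ W); rewrite v0 linear0.
Qed.

Lemma lifting_constituent (n m : nat) (rG : mx_representation F G n)
    (rV : mx_representation F G m) :
  irr_constituent rV rG -> exists K L, lifting rG rV K L.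
Proof.
case=> Us [compUs [_ [i _ simV]]].
have [B liftB] := lifting_rsim simV.
have [L lift _] := lifting_section (mx_subseries_module' i compUs.1)
                     (mx_subseries_module i compUs.1).
by do 2!eexists; apply: lifting_comp lift liftB.
Qed.

End Liftings.

Lemma lifting_subg (F : fieldType) (gT : finGroupType) (G H : {group gT})
    (sHG : H \subset G) (n m : nat) (rG : mx_representation F G n)
    (rV : mx_representation F G m) K L :
  lifting rG rV K L -> lifting (subg_repr rG sHG) (subg_repr rV sHG) K L.
Proof.
move=> [modK eqv inj]; split=> // [|g Hg]; last by apply: eqv; apply: (subsetP sHG).
by apply/mxmoduleP=> g Hg; apply: (mxmoduleP modK); apply: (subsetP sHG).
Qed.

(** * Constituents of the restriction of D^(5,4) to A_9 *)

Local Notation repD := (subg_repr (specht_quotient_repr 'F_2 9 la54) (Alt_subset 'I_9)).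
Local Notation repM := (subg_repr (tabloid_repr 'F_2 9 la54) (Alt_subset 'I_9)).

Section Constituent.

Variable rV : mx_representation 'F_2 ('Alt_('I_9))%G 8.

(** V becomes a section of the Specht module above its radical, where the Hamming coordinates are
    available. *)
Lemma constituent_lifting :
  irr_constituent rV repD ->
  exists K L, [/\ lifting repM rV K L, (spechtF :&: specht_perp 'F_2 9 la54 <= K)%MS,
                  (K <= spechtF)%MS & (L <= spechtF)%MS].
Proof.
move/lifting_constituent=> [K2 [L2 lift2]].
have [L1 lift1 sL1] := lifting_section (specht_rad_module 'F_2 9 la54)
                       (specht_module 'F_2 9 la54).
have sL1S : (L1 <= spechtF)%MS.
  by apply: submx_trans sL1 _; rewrite addsmx_sub capmxSl submx_refl.
have lift := lifting_comp (lifting_subg (Alt_subset 'I_9) lift1)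
                          lift2.
do 2!eexists; split; first exact: lift.
- exact: addsmxSr.
- by rewrite addsmx_sub capmxSl andbT (submx_trans _ sL1S) // submxMl.
by apply: submx_trans (submxMl _ _) sL1S.
Qed.

Definition half_mx (k : bool) : 'M['F_2]_(8, 8 + 8) :=
  if k then row_mx 0 1%:M else row_mx 1%:M 0.

Lemma pair_row_in_half (k : bool) (c : N) :
  pair_row (in_half k c) = bits_row 8 c *m half_mx k.
Proof.
by rewrite /pair_row; case: k; rewrite /= mul_mx_row mulmx0 mulmx1 bits_row0.
Qed.

Lemma star2_Alt (x y : nat) :
  (0 < x < 9)%N -> (0 < y < 9)%N -> (star x * star y)%g \in ('Alt_('I_9))%g.
Proof. by move=> xn yn; rewrite Alt_even odd_permM !odd_star. Qed.

Lemma specht_coords_star2 (m : nat) (u : 'M_(m, #|tabs|)) (x y : nat) :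
  (0 < x < 9)%N -> (0 < y < 9)%N -> (u <= spechtF)%MS ->
  u *m coords_mx *m swap_mx x *m swap_mx y =
    u *m mxtab (star x * star y)%g *m coords_mx.
Proof.
move=> xn yn su; rewrite mxtabM mulmxA.
rewrite [RHS](specht_coords_star yn (specht_module_mul _ su)).
by rewrite (specht_coords_star xn su).
Qed.

(** The coordinates turn the section V into a section X / Y of the sum of the halves. Some half lies
    in X and meets Y trivially, so it embeds in V, and both have dimension 8. *)
Lemma constituent_model :
  irr_constituent rV repD ->
  exists k (E : 'M['F_2]_8), E \in unitmx /\
    forall x y c, (0 < x < 9)%N -> (0 < y < 9)%N ->
      bits_row 8 (walk k [:: x; y] c) *m E =
        bits_row 8 c *m E *m rV (star x * star y)%g.
Proof.
move=> /constituent_lifting[K [L [[modK eqvL injL] sradK sKS sLS]]].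
(* On the Specht module the coordinates kill only vectors of the radical, which lies in [K]. *)
have inj (z : 'rV_8) : (z *m (L *m coords_mx) <= K *m coords_mx)%MS -> z = 0.
  case/submxP=> c; rewrite !mulmxA => /eqP; rewrite -subr_eq0 -mulmxBl => /eqP e0.
  have sS : (z *m L - c *m K <= spechtF)%MS.
    by rewrite addmx_sub ?eqmx_opp ?(submx_trans (submxMl _ _)).
  apply: injL; rewrite -[z *m L](subrK (c *m K)) addmx_sub ?submxMl //.
  by apply: submx_trans sradK; rewrite sub_capmx sS specht_coords_ker.
pose Y := K *m coords_mx; pose X := (L *m coords_mx + Y)%MS.
have eqvL' x y : (0 < x < 9)%N -> (0 < y < 9)%N ->
    (L *m coords_mx *m swap_mx x *m swap_mx y -
      rV (star x * star y)%g *m (L *m coords_mx) <= Y)%MS.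
  move=> xn yn; rewrite specht_coords_star2 // mulmxA -mulmxBl submxMr //.
  exact: eqvL (star2_Alt xn yn).
have stabY x y : (0 < x < 9)%N -> (0 < y < 9)%N ->
    (Y *m swap_mx x *m swap_mx y <= Y)%MS.
  move=> xn yn; rewrite specht_coords_star2 // submxMr //.
  exact: mxmoduleP modK _ (star2_Alt xn yn).
have stabX x y : (0 < x < 9)%N -> (0 < y < 9)%N ->
    (X *m swap_mx x *m swap_mx y <= X)%MS.
  move=> xn yn; rewrite (eqmxMr _ (addsmxMr _ _ _)) addsmxMr addsmx_sub.
  rewrite (submx_trans (stabY x y xn yn)) ?addsmxSr // andbT.
  rewrite -[X in (X <= _)%MS](subrK (rV (star x * star y)%g *m (L *m coords_mx))).
  rewrite addmx_sub //; first exact: submx_trans (eqvL' x y xn yn) (addsmxSr _ _).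
  exact: submx_trans (submxMl _ _) (addsmxSl _ _).
have closed m (A : 'M_(m, 8 + 8)) : (forall x y, (0 < x < 9)%N -> (0 < y < 9)%N ->
    (A *m swap_mx x *m swap_mx y <= A)%MS) ->
    swap2_closed (fun u => pair_row u <= A)%MS.
  move=> stabA; split=> [u v Au Av|x y u xn yn Au].
    by rewrite pair_row_xor2 addmx_sub.
  rewrite !pair_row_swap2; apply: submx_trans (stabA x y xn yn).
  by rewrite !submxMr.
(* X is not contained in Y, since V is nonzero and embeds modulo Y. *)
have [v vX vY] : exists2 v : 'rV_(8 + 8), (v <= X)%MS & ~~ (v <= Y)%MS.
  have /row_subPn[i] : ~~ (X <= Y)%MS.
    rewrite addsmx_sub submx_refl andbT; apply/negP=> sLK.
    have := inj (delta_mx 0 0) (submx_trans (submxMl _ _) sLK).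
    by move/rowP/(_ 0); rewrite !mxE.
  by exists (row i X); rewrite ?row_sub.
have [a [b [ca cb ev]]] := pair_row_onto v; subst v.
have sub_YX : subpred (fun u => pair_row u <= Y)%MS (fun u => pair_row u <= X)%MS.
  by move=> u /submx_trans; apply; apply: addsmxSr.
have Y0 : (pair_row (0, 0)%num <= Y)%MS.
  by rewrite /pair_row !bits_row0 row_mx0 sub0mx.
have [k [halfX halfY]] :=
  half_between (closed _ _ stabX) (closed _ _ stabY) sub_YX Y0 ca cb vX vY.
have sJX : (half_mx k <= X)%MS.
  apply/row_subP=> i; rewrite -[half_mx k]mul1mx row_mul.
  have [c cc ->] := bits_row_onto (row i 1%:M).
  by rewrite -pair_row_in_half; apply: halfX.
(* [E] sends a vector of the half to the element of V that represents it modulo Y. *)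
have [[E D] /= eJ] := sub_addsmxP sJX.
have injE (z : 'rV_8) : z *m E = 0 -> z = 0.
  have [c cc ->] := bits_row_onto z => zE.
  rewrite (halfY c cc) ?bits_row0 //= pair_row_in_half eJ mulmxDr mulmxA zE.
  by rewrite mul0mx add0r mulmxA submxMl.
exists k, E; split.
  rewrite -row_free_unit -kermx_eq0; apply/rowV0P=> z /sub_kermxP; exact: injE.
move=> x y c xn yn; set g := (star x * star y)%g.
set d := walk k [:: x; y] c; rewrite -[mulN _ (mulN _ _)]/d.
(* By [inj] it is enough to compare the images modulo Y, where both come from the action of [g] on
   the half. *)
apply/eqP; rewrite -subr_eq0; apply/eqP/inj.
have ed : bits_row 8 d *m half_mx k =
    bits_row 8 c *m half_mx k *m swap_mx x *m swap_mx y.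
  rewrite -!pair_row_in_half -!pair_row_swap2; congr pair_row.
  by rewrite /d /swap2; case: (k); rewrite /= !mulN0.
have zmodE (V : zmodType) (p q p' q' r : V) :
    p' + q' = p + q -> p' - r = q - q' + (p - r).
  move/(canRL (addrK q'))->; rewrite addrA; congr (_ - r).
  by rewrite [p + q]addrC addrAC.
rewrite eJ !mulmxDr !mulmxDl !mulmxA in ed.
rewrite mulmxBl !mulmxA (zmodE _ _ _ _ _ _ ed) addmx_sub //.
  rewrite addmx_sub ?eqmx_opp //; last by rewrite -mulmxA submxMl.
  rewrite -!mulmxA; do 2!apply: mulmx_sub.
  by have := stabY x y xn yn; rewrite -!mulmxA.
rewrite -!mulmxA -!mulmxBr; do 2!apply: mulmx_sub.
by have := eqvL' x y xn yn; rewrite -!mulmxA.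
Qed.

End Constituent.

(** * The invariant quadratic form *)

Definition mx_form (F : fieldType) (n : nat) (M : 'M[F]_n) (u v : 'rV[F]_n) : F :=
  (u *m M *m v^T) 0 0.

Lemma mx_form_bilinear (F : fieldType) (n : nat) (M : 'M[F]_n) :
  bilinear_for *%R *%R (mx_form M).
Proof.
rewrite /mx_form; split=> w a u v.
  by rewrite !mulmxDl -!scalemxAl !mxE.
by rewrite linearP /= mulmxDr -scalemxAr !mxE.
Qed.

HB.instance Definition _ (F : fieldType) (n : nat) (M : 'M[F]_n) :=
  bilinear_isBilinear.Build F 'rV[F]_n 'rV[F]_n F *%R *%R (mx_form M)
    (mx_form_bilinear M).

Lemma mx_form_tr (F : fieldType) (n : nat) (M : 'M[F]_n) (u v : 'rV[F]_n) :
  mx_form M^T u v = mx_form M v u.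
Proof.
rewrite /mx_form -[u]trmxK -mulmxA -!trmx_mul trmxK.
by rewrite mxE.
Qed.

Lemma mx_form_add (F : fieldType) (n : nat) (A B : 'M[F]_n) (u v : 'rV[F]_n) :
  mx_form (A + B) u v = mx_form A u v + mx_form B u v.
Proof. by rewrite /mx_form mulmxDr mulmxDl mxE. Qed.

Lemma mx_form_addl (F : fieldType) (n : nat) (A : 'M[F]_n) (u v w : 'rV[F]_n) :
  mx_form A (u + v) w = mx_form A u w + mx_form A v w.
Proof. by rewrite /mx_form !mulmxDl mxE. Qed.

Lemma mx_form_addr (F : fieldType) (n : nat) (A : 'M[F]_n) (u v w : 'rV[F]_n) :
  mx_form A u (v + w) = mx_form A u v + mx_form A u w.
Proof. by rewrite /mx_form raddfD mulmxDr mxE. Qed.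

Lemma mx_form_congr (F : fieldType) (n : nat) (A B : 'M[F]_n) (u v : 'rV[F]_n) :
  mx_form (B *m A *m B^T) u v = mx_form A (u *m B) (v *m B).
Proof. by rewrite /mx_form trmx_mul !mulmxA. Qed.

Lemma mx_form_sqrD (F : fieldType) (n : nat) (A : 'M[F]_n) (u v : 'rV[F]_n) :
  mx_form A (u + v) (u + v) =
    mx_form A u u + mx_form A v v + mx_form (A + A^T) u v.
Proof.
rewrite mx_form_add mx_form_tr mx_form_addl !mx_form_addr addrACA -!addrA.
by congr (_ + _); rewrite addrCA [RHS]addrCA; congr (_ + _); rewrite addrC.
Qed.

Lemma mx_form_sqrZ (F : fieldType) (n : nat) (A : 'M[F]_n) (a : F) (u : 'rV[F]_n) :
  mx_form A (a *: u) (a *: u) = a ^+ 2 * mx_form A u u.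
Proof.
by rewrite /mx_form -!scalemxAl linearZ /= -scalemxAr scalerA mxE expr2.
Qed.

Lemma mx_form_nondegenerate (n : nat) (A : 'M['F_2]_n) :
  A + A^T \in unitmx -> nondegenerate_quadratic_form (fun v => mx_form A v v).
Proof.
move=> unitA; exists (mx_form (A + A^T) : {biscalar 'rV['F_2]_n}).
  split=> [a u|u|u v] /=; first exact: mx_form_sqrZ.
    by rewrite mx_form_add mx_form_tr F2_double.
  exact: mx_form_sqrD.
move=> u fu; apply: (row_free_inj (A := A + A^T)); first by rewrite row_free_unit.
rewrite mul0mx; apply/rowP=> j; have := fu (delta_mx 0 j).
by rewrite /= /mx_form trmx_delta -colE !mxE.
Qed.

Definition split_mx : 'M['F_2]_8 :=
  \matrix_(i, j) ((i < 4)%N && (j == rev_ord i))%:R.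

(** The polarization pairs the coordinate i with 7 - i only. *)
Lemma split_mx_unit : split_mx + split_mx^T \in unitmx.
Proof.
suff -> : split_mx + split_mx^T = perm_mx (perm (@rev_ord_inj 8)).
  exact: unitmx_perm.
apply/matrixP=> i j; rewrite !mxE permE -natr_F2_addb; congr (_%:R).
rewrite -!val_eqE /=; have := ltn_ord i; have := ltn_ord j; lia.
Qed.

Definition quadN (a : N) : bool :=
  odd (count (fun i => bit a i && bit a (7 - i)) (iota 0 4)).

Lemma split_mx_quadN (a : N) :
  mx_form split_mx (bits_row 8 a) (bits_row 8 a) = (quadN a)%:R.
Proof.
rewrite /mx_form -mulmxA mxE.
under eq_bigr => i _.
  rewrite !mxE (bigD1 (rev_ord i)) //= big1 => [|j nej]; last first.
    by rewrite !mxE (negPf nej) andbF mul0r.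
  rewrite addr0 !mxE eqxx andbT; over.
rewrite !big_ord_recl big_ord0 /= /quadN natr_odd /=.
rewrite !(mul0r, mulr0, mul1r, addr0, addn0) !natrD -!mulnb !natrM.
by do 3!congr (_ + _).
Qed.

(** Each (0 x) carries the form on one half to the form on the other, so even words preserve it on
    each half. *)
Lemma quadN_check :
  all (fun k => all (fun x => all (fun a =>
    quadN (mulN (half_rows k x) a) == quadN a) codes) (iota 1 8))
  [:: false; true].
Proof. by vm_compute. Qed.

Lemma quadN_walk (k : bool) (w : seq nat) (a : N) :
  all (fun x => (0 < x < 9)%N) w -> a \in codes ->
  quadN (walk k w a) = quadN a.
Proof.
elim: w k a => //= x w IH k a /andP[xn wn] ca.
rewrite IH ?mulN_codes ?half_rows_codes //.
have /allP/(_ k (mem_halves k))/allP/(_ x)/[!mem_iota]/(_ xn) := quadN_check.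
by move=> /allP/(_ a ca)/eqP.
Qed.

(** * The spread *)

Local Notation A9 := ('Alt_('I_9))%G.
Definition pt7 : 'I_9 := Ordinal (isT : (7 < 9)%N).
Definition pt8 : 'I_9 := Ordinal (isT : (8 < 9)%N).

Lemma Alt_move2 (p q : 'I_9) :
  p != q -> exists r : 'S_9, [/\ r \in A9, r p = pt8 & r q = pt7].
Proof.
move=> nepq; have [r rp rq] : exists2 r : 'S_9, r p = pt8 & r q = pt7.
  (* The first transposition moves p to 8; the second brings the image of q to 7 and fixes 8. *)
  exists (tperm p pt8 * tperm (tperm p pt8 q) pt7)%g; last by rewrite permM tpermL.
  have neq : tperm p pt8 q != pt8.
    apply: contra nepq => /eqP e.
    by rewrite -(inj_eq (@perm_inj _ (tperm p pt8))) e tpermL.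
  by rewrite permM tpermL (tpermD neq).
case odd_r : (odd_perm r); last by exists r; rewrite Alt_even odd_r.
(* An odd [r] is corrected by (0 1), which fixes 7 and 8. *)
exists (r * star 1)%g; rewrite Alt_even odd_permM odd_r odd_star // !permM rp rq.
by rewrite !(@star_fix 2).
Qed.

Lemma Alt_move (p : 'I_9) : exists2 r : 'S_9, r \in A9 & r p = pt8.
Proof.
have [q neq] : exists q, p != q by exists (lift p ord0); apply: neq_lift.
by have [r [Ar rp _]] := Alt_move2 neq; exists r.
Qed.

(** * The module V in the coordinates of a half *)

Section Model.

Variables (rV : mx_representation 'F_2 A9 8) (k : bool) (E : 'M['F_2]_8).
Hypothesis unitE : E \in unitmx.
Hypothesis walkE : forall x y c, (0 < x < 9)%N -> (0 < y < 9)%N ->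
  bits_row 8 (walk k [:: x; y] c) *m E =
    bits_row 8 c *m E *m rV (star x * star y)%g.

Let ev (c : N) : 'rV['F_2]_8 := bits_row 8 c *m E.

Lemma ev_word (w : seq nat) (c : N) :
  even_word 9 w -> ev (walk k w c) = ev c *m rV (star_perm w).
Proof.
have [m] := ubnP (size w); elim: m w c => // m IH; rewrite /even_word.
move=> -[|x [|y w]] c; rewrite /= ?andbF //=.
  by rewrite /star_perm big_nil repr_mx1 mulmx1.
move=> ltwm /andP[/and3P[xn yn wn]]; rewrite negbK => ev_w.
have ew : even_word 9 w by rewrite /even_word wn.
have := IH w (walk k [:: x; y] c) (ltnW ltwm) ew.
rewrite /= negbK => ->; rewrite !star_perm_cons mulgA repr_mxM ?star2_Alt //.
  by rewrite [ev (mulN _ _)](walkE _ xn yn) mulmxA.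
exact: star_perm_Alt ew.
Qed.

Lemma ev_lxor (a b : N) : ev (N.lxor a b) = ev a + ev b.
Proof. by rewrite /ev bits_row_lxor mulmxDl. Qed.

Lemma ev_onto (v : 'rV['F_2]_8) : exists2 c, c \in codes & v = ev c.
Proof.
have [c cc ec] := bits_row_onto (v *m invmx E); exists c => //.
by rewrite /ev -ec mulmxKV.
Qed.

Lemma ev_inj (a b : N) : a \in codes -> b \in codes -> ev a = ev b -> a = b.
Proof.
move=> ca cb /(can_inj (mulmxK unitE)) eab.
have : N.lxor a b = 0%num.
  by apply: bits_row_eq0; rewrite ?lxor_codes // bits_row_lxor eab F2_addrr.
exact: N.lxor_eq.
Qed.

(** The split form of the half is transported to V through [E]. *)
Lemma model_quadratic_type : quadratic_type rV.
Proof.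
pose A := invmx E *m split_mx *m (invmx E)^T.
have evA c : mx_form A (ev c) (ev c) = (quadN c)%:R.
  by rewrite -split_mx_quadN mx_form_congr /ev mulmxK.
exists (fun v => mx_form A v v).
  apply: mx_form_nondegenerate.
  have -> : A + A^T = invmx E *m (split_mx + split_mx^T) *m (invmx E)^T.
    by rewrite mulmxDr mulmxDl /A !trmx_mul trmxK mulmxA.
  by rewrite !unitmx_mul split_mx_unit unitmx_tr unitmx_inv unitE.
move=> g v Ag; have [c cc ->] := ev_onto v.
have fixg (i : 'I_9) : (9 <= i)%N -> g i = i by rewrite leqNgt ltn_ord.
have [w ew ->] := even_star_perm (leqnn 9) fixg Ag.
rewrite -ev_word // !evA quadN_walk //.
by case/andP: ew.
Qed.

Definition low_mx : 'M['F_2]_8 := pid_mx 4 *m E.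

Lemma rank_low_mx : \rank low_mx = 4%N.
Proof. by rewrite mxrankMfree ?row_free_unit // rank_pid_mx. Qed.

Lemma low_mxP (v : 'rV['F_2]_8) :
  reflect (exists2 c, c \in low_codes & v = ev c) (v <= low_mx)%MS.
Proof.
apply: (iffP idP) => [/submxP[d ->]|[c lc ->]].
  have [c cc ec] := bits_row_onto (d *m pid_mx 4).
  exists c; last by rewrite /ev -ec mulmxA.
  by rewrite -low_codesE // -ec submxMl.
by rewrite submxMr // low_codesE ?low_codesS.
Qed.

(** An even permutation fixing 8 is an even word in the letters 1 to 7, and such words preserve
    [low_codes]. *)
Lemma low_mx_stable (m : nat) (A : 'M_(m, 8)) (h : 'S_9) :
  h \in A9 -> h pt8 = pt8 -> (A <= low_mx)%MS -> (A *m rV h <= low_mx)%MS.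
Proof.
move=> Ah h8 sA; apply/row_subP=> i; rewrite row_mul.
have /low_mxP[c lc ->] : (row i A <= low_mx)%MS by rewrite (submx_trans (row_sub i A)).
have fixh (j : 'I_9) : (8 <= j)%N -> h j = j.
  by move=> le8j; have -> : j = pt8 by apply: val_inj => /=; have := ltn_ord j; lia.
have [w ew ->] := even_star_perm (leqnSn 8) fixh Ah.
have ew9 : even_word 9 w.
  case/andP: ew => wn; rewrite /even_word => ->; rewrite andbT.
  by apply: sub_all wn => x /andP[-> /=]; apply: ltnW.
rewrite -ev_word //; apply/low_mxP; eexists; last by [].
have closed : walk_closed 8 k (fun a => a \in low_codes).
  split=> [a b la lb|x y a]; last exact: low_stable.
  have ca := low_codesS la; have cb := low_codesS lb.
  move: la lb; rewrite -!low_codesE ?lxor_codes // bits_row_lxor; exact: addmx_sub.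
exact: walk_closed_word closed ew lc.
Qed.

(** By [walk_closed_one] the subspace contains the fixed vector 1, hence its orbit under the
    stabilizer. *)
Lemma low_mx_min (m : nat) (A : 'M_(m, 8)) :
    A != 0 ->
    (forall h, h \in A9 -> h pt8 = pt8 -> (A *m rV h <= A)%MS) ->
  (low_mx <= A)%MS.
Proof.
move=> A0 stabA; pose P c := (ev c <= A)%MS.
have closed : walk_closed 8 k P.
  split=> [a b Pa Pb|x y a xn yn Pa]; first by rewrite /P ev_lxor addmx_sub.
  have fix8 z : (0 < z < 8)%N -> star z pt8 = pt8 by apply: star_fix.
  rewrite /P /ev walkE; try by lia.
  apply: submx_trans (submxMr _ Pa) (stabA _ _ _); last by rewrite permM !fix8.
  by apply: star2_Alt; lia.
have [i Ai0] : exists i, row i A != 0.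
  apply/existsP; apply: contraR A0; rewrite negb_exists => /forallP A0.
  by apply/eqP/row_matrixP=> i; rewrite row0; apply/eqP; have := A0 i; rewrite negbK.
have [c cc ec] := ev_onto (row i A).
have P1 : P 1%num.
  apply: (walk_closed_one closed cc); last by rewrite /P -ec row_sub.
  by apply: contraNneq Ai0 => c0; rewrite ec c0 /ev bits_row0 mul0mx.
apply/row_subP=> j; have /low_mxP[d ld ->] := row_sub j low_mx.
exact: walk_closed_low closed P1 ld.
Qed.

(** Q takes a single value on the nonzero low vectors, so the polarization takes that same value on
    any two distinct ones; additivity then forces it to be 0. *)
Lemma low_mx_singular (Q : 'rV['F_2]_8 -> 'F_2) :
  nondegenerate_quadratic_form Q -> invariant_form rV Q ->
  totally_singular Q low_mx.
Proof.
case=> f [QZ _ QD] _ Qinv v /low_mxP[c lc ->].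
have Qc d : d \in low_codes -> d != 0%num -> Q (ev d) = Q (ev 1%num).
  move=> ld d0; have [x [y [xn yn ->]]] := low_orbit k ld d0.
  have xn9 : (0 < x < 9)%N by lia.
  have yn9 : (0 < y < 9)%N by lia.
  by rewrite /ev walkE // Qinv // star2_Alt.
have fc a b : a \in low_codes -> b \in low_codes -> a != 0%num -> b != 0%num ->
    N.lxor a b \in low_codes -> N.lxor a b != 0%num ->
    f (ev a) (ev b) = Q (ev 1%num).
  move=> la lb a0 b0 lab ab0; have := QD (ev a) (ev b).
  by rewrite -ev_lxor !Qc // F2_double add0r => <-.
have Q1 : Q (ev 1%num) = 0.
  (* f(1, 6) = f(1, 2) + f(1, 4), and all three equal Q(1). *)
  rewrite -(fc 1 6)%num // (_ : 6%num = N.lxor 2 4)%num // ev_lxor linearDr.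
  by rewrite /= !fc // F2_double.
have [->|c0] := eqVneq c 0%num; last by rewrite Qc.
by rewrite /ev bits_row0 mul0mx -(scale0r 0) QZ expr0n mul0r.
Qed.

End Model.

Section Spread.

Variables (rV : mx_representation 'F_2 A9 8) (k : bool) (E : 'M['F_2]_8).
Hypothesis unitE : E \in unitmx.
Hypothesis walkE : forall x y c, (0 < x < 9)%N -> (0 < y < 9)%N ->
  bits_row 8 (walk k [:: x; y] c) *m E =
    bits_row 8 c *m E *m rV (star x * star y)%g.

(** An even permutation moving the images of 8 under a and b to 8 and 7 carries the pair to the low
    subspace and its translate by (0 8)(0 7), the pair treated by [low_disjoint]. *)
Lemma low_mx_disjoint (a b : 'S_9) :
    a \in A9 -> b \in A9 -> a pt8 != b pt8 ->
  (low_mx E *m rV a :&: low_mx E *m rV b)%MS = 0.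
Proof.
move=> Aa Ab neab; have [r [Ar ra rb]] := Alt_move2 neab.
apply/eqP/rowV0P=> v; rewrite sub_capmx => /andP[va vb].
have t87 : (star 8 * star 7)%g pt8 = pt7.
  have e8 : inord 8 = pt8 by apply: val_inj; rewrite /= inordK.
  have e7 : inord 7 = pt7 by apply: val_inj; rewrite /= inordK.
  by rewrite permM /star e8 e7 tpermR tpermL.
(* Both [b * r] and [t] send 8 to 7, so they differ by an element [s] of the stabilizer of 8. *)
pose t := (star 8 * star 7)%g; pose s := (b * r * t^-1)%g.
have At : t \in A9 by apply: star2_Alt.
have As : s \in A9 by rewrite !groupM ?groupV.
have s8 : s pt8 = pt8 by rewrite !permM rb -t87 permK.
have vrb : (v *m rV r <= low_mx E *m rV t)%MS.
  apply: submx_trans (submxMr _ vb) _.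
  have -> : low_mx E *m rV b *m rV r = low_mx E *m rV s *m rV t.
    by rewrite -!mulmxA -!repr_mxM // /s mulgKV.
  by rewrite submxMr // (low_mx_stable unitE walkE).
have vra : (v *m rV r <= low_mx E)%MS.
  apply: submx_trans (submxMr _ va) _; rewrite -mulmxA -repr_mxM //.
  by rewrite (low_mx_stable unitE walkE) ?groupM // permM.
have [c lc ec] := low_mxP E _ vra.
have [d] := submxP vrb; rewrite mulmxA => ed.
have [e le ee] : exists2 e, e \in low_codes & d *m low_mx E = bits_row 8 e *m E.
  by apply/low_mxP; apply: submxMl.
have e0 : e = 0%num.
  apply: (low_disjoint (k := k) le); suff <- : c = walk k [:: 8; 7] e by [].
  apply: (ev_inj unitE); rewrite ?walk_codes ?low_codesS //.
  by rewrite -ec ed ee walkE.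
have vr0 : v *m rV r = 0 by rewrite ed ee e0 bits_row0 !mul0mx.
by rewrite -(repr_mxK rV Ar v) vr0 mul0mx.
Qed.

Lemma stabilizerP (x : 'I_9) (h : 'S_9) :
  reflect (h \in A9 /\ h x = x) (h \in 'C_('Alt_('I_9))[x | 'P])%g.
Proof.
apply: (iffP setIP) => -[Ah hx]; split=> //.
  by move/astab1P: hx; rewrite /= apermE.
by apply/astab1P; rewrite /= apermE.
Qed.

(** Conjugation by [a] turns the stabilizer of x into that of 8, where [low_mx_min] applies;
    simplicity of U makes the inclusion an equality. *)
Lemma simple_low_mx (x : 'I_9) (U : 'M['F_2]_8) (a : 'S_9) :
    mxsimple (subg_repr rV (subsetIl _ _ :
      ('C_('Alt_('I_9))[x | 'P] \subset 'Alt_('I_9))%g)) U ->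
    a \in A9 -> a x = pt8 ->
  (U :=: low_mx E *m rV a^-1%g)%MS.
Proof.
case=> modU U0 minU Aa ax; have AaV : a^-1%g \in A9 by rewrite groupV.
have sUa : (low_mx E <= U *m rV a)%MS.
  apply: (low_mx_min unitE walkE) => [|h Ah h8].
    apply: contraNneq U0 => Ua0.
    by rewrite -(repr_mxK rV Aa U) Ua0 mul0mx.
  have -> : U *m rV a *m rV h = U *m rV (a * h * a^-1)%g *m rV a.
    by rewrite -!mulmxA -!repr_mxM ?groupM // mulgKV.
  apply: submxMr; apply: (mxmoduleP modU); apply/stabilizerP.
  by rewrite !groupM // !permM ax h8 -ax permK.
have sU : (low_mx E *m rV a^-1%g <= U)%MS.
  by rewrite -(repr_mxK rV Aa U) submxMr.
apply/eqmxP/andP; split=> //; apply: minU => //.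
  apply/mxmoduleP=> h /stabilizerP[Ah hx] /=.
  have -> : low_mx E *m rV a^-1%g *m rV h =
      low_mx E *m rV (a^-1 * h * a)%g *m rV a^-1%g.
    by rewrite -!mulmxA -!repr_mxM ?groupM // mulgK.
  rewrite submxMr // (low_mx_stable unitE walkE) ?groupM //.
  by rewrite !permM -{1}ax permK hx.
apply/eqP=> low0; have := rank_low_mx unitE.
by rewrite -(repr_mxKV rV Aa (low_mx E)) low0 mul0mx mxrank0.
Qed.

End Spread.

Theorem theorem3
    (rV : mx_representation 'F_2 'Alt_('I_9) 8)
    (hV : irr_constituent rV
            (subg_repr (specht_quotient_repr 'F_2 9 [:: 5; 4]%N)
                       (Alt_subset 'I_9))) :
  quadratic_type rV /\
  forall Q : 'rV['F_2]_8 -> 'F_2,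
    nondegenerate_quadratic_form Q -> invariant_form rV Q ->
  forall (x : 'I_9) (U : 'M['F_2]_8),
    mxsimple (subg_repr rV (subsetIl _ _ :
                ('C_('Alt_('I_9))[x | 'P] \subset 'Alt_('I_9))%g)) U ->
    [/\ \rank U = 4%N,
        totally_singular Q U
      & forall g : 'I_9 -> 'S_9,
          coset_representatives ('C_('Alt_('I_9))[x | 'P])%g ('Alt_('I_9))%g g ->
          complete_orthogonal_spread 4 Q
            [set <<U *m rV (g i)>>%MS | i : 'I_9]].
Proof.
have [k [E [unitE walkE]]] := constituent_model hV.
split=> [|Q ndQ invQ x U simU]; first exact: model_quadratic_type unitE walkE.
have [a Aa ax] := Alt_move x; have AaV : a^-1%g \in A9 by rewrite groupV.
have eU := simple_low_mx unitE walkE simU Aa ax.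
have singU : totally_singular Q U.
  move=> v; rewrite eU => vU; rewrite -(invQ a) //.
  apply: (low_mx_singular unitE walkE ndQ invQ).
  by rewrite -(repr_mxKV rV Aa (low_mx E)) submxMr.
have rankU (h : 'S_9) : h \in A9 -> \rank (U *m rV h) = \rank U.
  by move=> Ah; rewrite mxrankMfree // row_free_unit repr_mx_unit.
have rankU4 : \rank U = 4%N.
  by rewrite eU mxrankMfree ?rank_low_mx ?row_free_unit ?repr_mx_unit.
split=> // g [Ag repg].
(* The i-th member is the translate of the low subspace by [a^-1 * g i], which sends 8 to
   [g i x]. *)
have disj i j : g i x != g j x -> (U *m rV (g i) :&: U *m rV (g j) = 0)%MS.
  move=> neij; apply/eqP; rewrite -submx0.
  have UgE h : h \in A9 -> (U *m rV h :=: low_mx E *m rV (a^-1 * h)%g)%MS.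
    by move=> Ah; rewrite repr_mxM // mulmxA; apply: eqmxMr.
  rewrite (cap_eqmx (UgE _ (Ag i)) (UgE _ (Ag j))) submx0.
  apply/eqP/(low_mx_disjoint unitE walkE); rewrite ?groupM //.
  by rewrite !permM -ax permK.
(* If the two images of x agree, [g i * (g j)^-1] fixes x and the cosets coincide. *)
have gx_inj i j : g i x = g j x -> i = j.
  move=> eij; have [l [_ uniq_l]] := repg _ (Ag i).
  rewrite -(uniq_l i) ?rcoset_refl //; apply: uniq_l.
  rewrite mem_rcoset; apply/stabilizerP; rewrite groupM ?groupV //; split=> //.
  by rewrite permM eij permK.
have disj' i j : i != j -> (U *m rV (g i) :&: U *m rV (g j) = 0)%MS.
  by move=> neij; apply: disj; apply: contra_neq neij; apply: gx_inj.
split; last first.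
  (* The count is 2^3 + 1 = 9; two equal members would meet in dimension 4 instead of 0. *)
  rewrite card_imset ?card_ord ?card_Fp // => i j eij.
  apply/eqP; apply: contraT => /disj'; move/(congr1 (fun W : 'M_8 => \rank W)).
  have -> : (U *m rV (g i) :&: U *m rV (g j) :=: U *m rV (g i))%MS.
    by apply/capmx_idPl; rewrite -(genmxE (U *m rV (g j))) -eij genmxE.
  by rewrite rankU // rankU4 mxrank0.
(* U itself shows that Q has a totally singular subspace of dimension 4. *)
split=> //; first by exists U.
  move=> _ /imsetP[i _ ->]; rewrite genmx_id genmxE rankU //; split=> // v.
  rewrite genmxE => vU; rewrite -(invQ (g i)^-1%g) ?groupV //; apply: singU.
  by rewrite -(repr_mxK rV (Ag i) U) submxMr.
move=> _ _ /imsetP[i _ ->] /imsetP[j _ ->] neW.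
have neij : i != j by apply: contraNneq neW => ->.
by apply/eqP; rewrite -submx0 (cap_eqmx (genmxE _) (genmxE _)) disj'.
Qed.
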